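(* Let $X$ be a set and let $b\in\mathbf{k}$, $b\ne0$. Let $\mathfrak X_\infty$ be the set of differential Rota-Baxter bracketed words on $X$, with the product $\diamond$ and the linear operators $d_{\mathfrak X}$, $P_{\mathfrak X}$ on $\mathbf{k}\mathfrak X_\infty$ defined in the context. Then the para-differential Rota-Baxter algebra $(\mathbf{k}\mathfrak X_\infty,\diamond,d_{\mathfrak X},P_{\mathfrak X})$, together with the set embedding $j_X:X\to\mathbf{k}\mathfrak X_\infty$, $x\mapsto x$, is the free para-differential Rota-Baxter algebra of type III (with this $b$) on $X$. That is, it is a para-differential Rota-Baxter algebra of type III, and for every para-differential Rota-Baxter algebra $(R,d,P)$ of type III with the same $b$ and every map $f:X\to R$ there is a unique algebra homomorphism $\bar f:\mathbf{k}\mathfrak X_\infty\to R$ with $\bar fd_{\mathfrak X}=d\bar f$, $\bar fP_{\mathfrak X}=P\bar f$ and $\bar f\circ j_X=f$.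
   Context: $\mathbf{k}$ is a commutative ring with identity. The standing convention is that, unless otherwise noted, one works in the categories of associative $\mathbf{k}$-algebras with identity, with or without linear operators. A para-differential Rota-Baxter algebra of type III (for $0\neq b\in\mathbf{k}$) is a triple $(R,d,P)$ with $R$ an algebra and $d,P:R\to R$ linear maps such that $d$ is a differential operator of weight $0$, meaning $d(xy)=d(x)y+xd(y)$ for all $x,y\in R$ and $d(\mathbf 1_R)=0$; $P$ is a Rota-Baxter operator of weight $0$, meaning $P(x)P(y)=P(P(x)y)+P(xP(y))$ for all $x,y\in R$; and $dP=Pd+bP$. Words. For a set $Y$, $S(Y)$ is the free semigroup on $Y$ (nonempty words). For $\Omega=\{D,P\}$ with $D\neq P$, let $\mathfrak S_\Omega(X)$ be the free semigroup with two unary operations $D,P$ on $X$: $\mathfrak S_{\Omega,0}(X)=S(X)$, $\mathfrak S_{\Omega,n+1}(X)=S\big(X\sqcup P(\mathfrak S_{\Omega,n}(X))\sqcup D(\mathfrak S_{\Omega,n}(X))\big)$ with $P(Y),D(Y)$ disjoint formal copies of $Y$, and $\mathfrak S_\Omega(X)=\bigcup_n\mathfrak S_{\Omega,n}(X)$. For subsets $Y,Z$ of $\mathfrak S_\Omega(X)$ put $$\Lambda(Y,Z)=\Big(\bigcup_{r\ge1}(YP(Z))^r\Big)\cup\Big(\bigcup_{r\ge0}(YP(Z))^rY\Big)\cup\Big(\bigcup_{r\geq1}(P(Z)Y)^r\Big)\cup\Big(\bigcup_{r\ge0}(P(Z)Y)^rP(Z)\Big).$$ Let $\Delta(X)=\{D^n(x)\mid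 x\in X,n\ge0\}$, $\mathfrak X_0=S(\Delta(X))$, $\mathfrak X_n=\Lambda(\mathfrak X_0,\mathfrak X_{n-1})$ for $n\ge1$; then $\mathfrak X_{n}\subseteq\mathfrak X_{n+1}$ and $\mathfrak X_\infty=\bigcup_{n\ge0}\mathfrak X_n$. Each $u\in\mathfrak X_\infty$ has a unique standard decomposition $u=u_1\cdots u_m$ with the $u_i$ alternately in $\mathfrak X_0$ and in $P(\mathfrak X_\infty)$; $\mathrm{b}(u):=m$ is the breadth, and $\mathrm{dep}_P(u):=\min\{k\mid u\in\mathfrak X_k\}$. $\mathbf{k}\mathfrak X_\infty$ is the free $\mathbf{k}$-module on $\mathfrak X_\infty$. All maps below are defined on basis elements and extended (bi)linearly; juxtaposition is concatenation, extended multilinearly. Rota-Baxter operator: $P_{\mathfrak X}(u)=P(u)$ for $u\in\mathfrak X_\infty$. Product $\diamond$, by recursion on $\mathrm{dep}_P(u)+\mathrm{dep}_P(v)$: for $u,v\in\mathfrak X_0$, $u\diamond v=uv$. If $\mathrm b(u)=\mathrm b(v)=1$, then $u\diamond v=P(\bar u\diamond P(\bar v))+P(P(\bar u)\diamond\bar v)$ when $u=P(\bar u)$ and $v=P(\bar v)$, and $u\diamond v=uv$ otherwise. If $\mathrm b(u)>1$ or $\mathrm b(v)>1$, with standard decompositions $u=u_1\cdots u_m$, $v=v_1\cdots v_n$, then $u\diamond v=u_1\cdots u_{m-1}(u_m\diamond v_1)v_2\cdots v_n$. Operator $d_{\mathfrak X}$, by recursion on $\mathrm{dep}_P(u)$: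 $d_{\mathfrak X}(u)=D(u)$ for $u\in\Delta(X)$; for $u=u_1\cdots u_m$ with $m\geq2$, where either all $u_i\in\Delta(X)$ (if $u\in\mathfrak X_0$) or $u_1\cdots u_m$ is the standard decomposition (if $u\notin\mathfrak X_0$), $$d_{\mathfrak X}(u)=d_{\mathfrak X}(u_1)u_2\cdots u_m+u_1d_{\mathfrak X}(u_2\cdots u_m);$$ and $d_{\mathfrak X}(P(\bar u))=P_{\mathfrak X}(d_{\mathfrak X}(\bar u))+bP(\bar u)$ for $\bar u\in\mathfrak X_\infty$.
   Formalization: Algebras are not required to have an identity and homomorphisms need not preserve one: words are nonempty, so the constructed algebra has no identity for nonempty X (w⋄x=wx≠x), and it is zero for empty X; the condition d(1)=0 is imposed only on an identity that exists. *)

(* Defs.v *)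
From HB Require Import structures.
From mathcomp Require Import all_boot all_order all_algebra finmap monalg.
From mathcomp Require Import boolp classical_sets.

Set Implicit Arguments.
Unset Strict Implicit.
Unset Printing Implicit Defensive.

Import GRing.Theory.
Local Open Scope classical_set_scope.
Local Open Scope ring_scope.

(* Bracketed words.  [seq (letter X)] is the free monoid with two unary
   operations; the empty word is allowed here only because it is the unit of
   concatenation.  The sets of words below consist of nonempty words whose
   brackets are nonempty, so they lie in the free operated semigroup. *)
Inductive letter (X : Type) : Type :=
| Gen of X
| Dbr of seq (letter X)
| Pbr of seq (letter X).

Definition word (X : Type) : Type := seq (letter X).

HB.instance Definition _ (X : Type) := gen_eqMixin (letter X).
HB.instance Definition _ (X : Type) := gen_choiceMixin (letter X).
HB.instance Definition _ (X : Type) := Choice.copy (word X) (seq (letter X)).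

Section WordMonoid.
Variable X : Type.

Definition cat_word : word X -> word X -> word X := @cat (letter X).

Lemma cat_wordA : associative cat_word. Proof. exact: catA. Qed.
Lemma cat_word0w : left_id ([::] : word X) cat_word. Proof. by []. Qed.
Lemma cat_wordw0 : right_id ([::] : word X) cat_word. Proof. exact: cats0. Qed.
Lemma cat_word_eq0 (u v : word X) :
  cat_word u v = [::] -> u = [::] /\ v = [::].
Proof. by case: u. Qed.

HB.instance Definition _ := Choice_isMonomialDef.Build (word X)
  cat_wordA cat_word0w cat_wordw0 cat_word_eq0.

Definition Gw (x : X) : word X := [:: Gen x].
Definition Dw (w : word X) : word X := [:: Dbr w].
Definition Pw (w : word X) : word X := [:: Pbr w].

Definition isP (a : letter X) : bool := if a is Pbr _ then true else false.

Definition wprod (Y Z : set (word X)) : set (word X) :=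
  [set cat_word u v | u in Y & v in Z].

Fixpoint wpow (Y : set (word X)) (r : nat) : set (word X) :=
  if r is r'.+1 then wprod Y (wpow Y r') else [set ([::] : word X)].

Definition free_sg (Y : set (word X)) : set (word X) :=
  \bigcup_(r in [set r | (1 <= r)%N]) wpow Y r.

Definition Pset (Z : set (word X)) : set (word X) := [set Pw z | z in Z].

Definition Lambda (Y Z : set (word X)) : set (word X) :=
  (\bigcup_(r in [set r | (1 <= r)%N]) wpow (wprod Y (Pset Z)) r)
  `|` (\bigcup_r wprod (wpow (wprod Y (Pset Z)) r) Y)
  `|` (\bigcup_(r in [set r | (1 <= r)%N]) wpow (wprod (Pset Z) Y) r)
  `|` (\bigcup_r wprod (wpow (wprod (Pset Z) Y) r) (Pset Z)).

Definition Delta : set (word X) :=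
  [set w | exists (x : X) (n : nat), w = iter n Dw (Gw x)].

Definition X0 : set (word X) := free_sg Delta.

Fixpoint Xn (n : nat) : set (word X) :=
  if n is n'.+1 then Lambda X0 (Xn n') else X0.

Definition Xinf : set (word X) := \bigcup_n Xn n.

(* Standard decomposition: each maximal run of letters other than P(w) is one
   block, and each letter P(w) is a block (see [std_alternating] and
   [std_unique]). *)
Fixpoint std (w : word X) : seq (word X) :=
  if w is a :: w' then
    if isP a then [:: a] :: std w' else
    if std w' is s :: t then
      if s is Pbr _ :: _ then [:: a] :: s :: t else (a :: s) :: t
    else [:: [:: a]]
  else [::].

Definition breadth (w : word X) : nat := size (std w).

(* Nesting depth of P; it is dep_P on Xinf by [Xn_depP]. *)
Fixpoint depP_letter (a : letter X) : nat :=
  if a is Pbr w then (foldr maxn 0%N (map depP_letter w)).+1 else 0%N.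

Definition depP (w : word X) : nat := foldr maxn 0%N (map depP_letter w).

End WordMonoid.

Arguments X0 {X}.
Arguments Xinf {X}.
Arguments Delta {X}.

Section FreeModule.
Variables (k : comNzRingType) (X : Type).

(* In {malg k[word X]}, the free module on all words, the ring product is the
   multilinear extension of concatenation. *)
Definition lext (V : lmodType k) (f : word X -> V) (g : {malg k[word X]}) : V :=
  \sum_(w <- msupp g) g@_w *: f w.

Definition PW : {malg k[word X]} -> {malg k[word X]} :=
  lext (fun w => << Pw w >> : {malg k[word X]}).

(* [dia1] is the breadth one case, [rec] standing for the product of smaller
   P-depth. *)
Definition dia1 (rec : word X -> word X -> {malg k[word X]}) (u v : word X) :
    {malg k[word X]} :=
  match u, v with
  | [:: Pbr u'], [:: Pbr v'] => PW (rec u' (Pw v')) + PW (rec (Pw u') v')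
  | _, _ => << cat_word u v >>
  end.

Definition dia_step (rec : word X -> word X -> {malg k[word X]})
    (u v : word X) : {malg k[word X]} :=
  let s := std u in let t := std v in
  << flatten (take (size s).-1 s) : word X >>
  * dia1 rec (last [::] s) (head [::] t)
  * << flatten (behead t) : word X >>.

Fixpoint dia_rec (n : nat) (u v : word X) : {malg k[word X]} :=
  if n is n'.+1 then dia_step (dia_rec n') u v else 0.

(* The bound is large enough for the recursion never to reach its default
   value: see [diaw_PP]. *)
Definition diaw (u v : word X) : {malg k[word X]} :=
  dia_rec (depP u + depP v).+1 u v.

Definition diaW (f g : {malg k[word X]}) : {malg k[word X]} :=
  lext (fun u => lext (diaw u) g) f.

Definition leibniz (dl : letter X -> {malg k[word X]}) :
    word X -> {malg k[word X]} :=
  fix dw (w : word X) : {malg k[word X]} :=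
    if w is a :: w' then
      dl a * << w' : word X >> + << [:: a] : word X >> * dw w'
    else 0.

Variable b : k.

Fixpoint d_letter (a : letter X) : {malg k[word X]} :=
  if a is Pbr w then PW (leibniz d_letter w) + b *: << Pw w >>
  else << Dw [:: a] >>.

(* The Leibniz rule is applied letter by letter; by [dw_cat] this agrees with
   any decomposition of the word into factors. *)
Definition dw : word X -> {malg k[word X]} := leibniz d_letter.

Definition dW : {malg k[word X]} -> {malg k[word X]} := lext dw.

End FreeModule.

Section WordTheory.
Variable X : Type.
Implicit Types (a c : letter X) (u v w : word X) (A B C Y Z : set (word X)).

Definition noPP : rel (letter X) := fun a c => ~~ (isP a && isP c).

Lemma Delta_letter w : Delta w -> exists2 a, w = [:: a] & ~~ isP a.
Proof.
move=> [x [n ->]]; case: n => [|n]; first by exists (Gen x).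
by exists (Dbr (iter n (@Dw X) (Gw x))).
Qed.

Lemma Delta_notP a : Delta [:: a] -> ~~ isP a.
Proof. by move=> /Delta_letter[c [->]]. Qed.

Lemma wpow_DeltaE r w :
  wpow Delta r w <-> size w = r /\ forall a, a \in w -> Delta [:: a].
Proof.
elim: r w => [|r IH] w /=.
  by split=> [->|[/size0nil]].
split=> [[u Du [v /IH[vr Dv] <-]]|].
  have [a ea _] := Delta_letter Du; rewrite ea in Du *.
  split=> /=; first by rewrite vr.
  by move=> c; rewrite inE => /orP[/eqP->|/Dv].
case: w => [[]//|a w [[wr] Dw]].
exists [:: a]; first by apply: Dw; rewrite inE eqxx.
by exists w => //; apply/IH; split=> // c cw; apply: Dw; rewrite inE cw orbT.
Qed.

Lemma X0E w : X0 w <-> w <> [::] /\ forall a, a \in w -> Delta [:: a].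
Proof.
split=> [[r /= r0 /wpow_DeltaE[wr Dw]]|[w0 Dw]].
  by split=> // w0; rewrite -wr w0 in r0.
by exists (size w); [case: w w0 Dw|apply/wpow_DeltaE].
Qed.

Lemma X0_cat u v : X0 u -> X0 v -> X0 (cat_word u v).
Proof.
move=> /X0E[u0 Du] /X0E[v0 Dv]; apply/X0E; split; first by case: u u0 Du.
by move=> a; rewrite mem_cat => /orP[/Du|/Dv].
Qed.

Lemma X0_notP w : X0 w -> forall a, a \in w -> ~~ isP a.
Proof. by move=> /X0E[_ Dw] a /Dw/Delta_notP. Qed.

(* Letters allowed in a word of Lambda(X0, Z). *)
Definition okl Z a := Delta [:: a] \/ exists2 z, Z z & a = Pbr z.

Definition okw Z w :=
  [/\ w <> [::], sorted noPP w & forall a, a \in w -> okl Z a].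

Definition endsP (w : word X) := last false (map (@isP X) w).
Definition headP (w : word X) := head false (map (@isP X) w).

Lemma okw_cat Z u v : okw Z u -> okw Z v -> ~~ (endsP u && headP v) ->
  okw Z (cat_word u v).
Proof.
move=> [u0 Pu Zu] [v0 Pv Zv] uv; split; first by case: u u0 {Pu Zu uv}.
  case: u u0 Pu uv {Zu} => // a u _ /= Pu uv.
  rewrite cat_path Pu /=; case: v v0 Pv uv {Zv} => // c v _ /= -> uv.
  by rewrite andbT /noPP -(last_map (@isP X)).
by move=> a; rewrite mem_cat => /orP[/Zu|/Zv].
Qed.

Lemma X0_okw Z w : X0 w -> [/\ okw Z w, ~~ endsP w & ~~ headP w].
Proof.
move=> X0w; have nP := X0_notP X0w; move/X0E: X0w => [w0 Dw].
split; last by case: w w0 nP {Dw} => //= a w _ -> //; rewrite inE eqxx.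
  split=> // [|a /Dw]; last by left.
  case: w w0 nP {Dw} => //= a w _ nP; apply/(pathP a) => i iw.
  by rewrite /noPP (negPf (nP _ _)) // mem_nth //= ltnS ltnW.
case: w w0 nP {Dw} => //= a w _ nP.
by rewrite /endsP /= last_map nP // mem_last.
Qed.

Lemma Pset_okw Z w : Pset Z w -> [/\ okw Z w, endsP w & headP w].
Proof.
move=> [z Zz <-]; split=> //; split=> // a; rewrite inE => /eqP->.
by right; exists z.
Qed.

Lemma okw_wprod Z (A B : set (word X)) (hA eA hB eB : bool) :
  (forall w, A w -> [/\ okw Z w, endsP w = eA & headP w = hA]) ->
  (forall w, B w -> [/\ okw Z w, endsP w = eB & headP w = hB]) ->
  ~~ (eA && hB) ->
  forall w, wprod A B w -> [/\ okw Z w, endsP w = eB & headP w = hA].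
Proof.
move=> HA HB AB w [u /HA[ou eu hu] [v /HB[ov ev hv] <-]].
split; first by apply: okw_cat => //; rewrite eu hv.
  case: v ov ev {hv} => [[]//|c v] _ <-.
  by rewrite /endsP map_cat last_cat.
by case: u ou hu {eu} => [[]|].
Qed.

Lemma okw_wpow Z A (h e : bool) :
  (forall w, A w -> [/\ okw Z w, endsP w = e & headP w = h]) -> ~~ (e && h) ->
  forall r w, (0 < r)%N -> wpow A r w ->
    [/\ okw Z w, endsP w = e & headP w = h].
Proof.
move=> HA eh; elim=> // -[_|r IH] w _.
  by move=> /= [u /HA Hu [v -> <-]]; rewrite /cat_word cats0.
by apply: (okw_wprod HA _ eh) => v; apply: IH.
Qed.

Lemma okw_wpowprod Z A B (h e e' : bool) :
  (forall w, A w -> [/\ okw Z w, endsP w = e & headP w = h]) ->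
  (forall w, B w -> [/\ okw Z w, endsP w = e' & headP w = h]) ->
  ~~ (e && h) -> forall r w, wprod (wpow A r) B w ->
    [/\ okw Z w, endsP w = e' & headP w = h].
Proof.
move=> HA HB eh [|r] w.
  by move=> [u -> [v /HB Hv <-]].
apply: (okw_wprod _ HB eh) => v; exact: (okw_wpow HA).
Qed.

Lemma wprodA A B C : wprod (wprod A B) C = wprod A (wprod B C).
Proof.
apply/seteqP; split=> w.
  move=> [_ [u Au [v Bv <-]] [z Cz <-]]; exists u => //.
  by exists (cat_word v z); [exists v => //; exists z|rewrite cat_wordA].
move=> [u Au [_ [v Bv [z Cz <-]] <-]].
exists (cat_word u v); first by exists u => //; exists v.
by exists z => //; rewrite cat_wordA.
Qed.

Lemma wprod1 A : wprod [set ([::] : word X)] A = A.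
Proof.
apply/seteqP; split=> w; first by move=> [_ -> [v Av <-]].
by move=> Aw; exists [::] => //; exists w.
Qed.

Lemma wprodr1 A : wprod A [set ([::] : word X)] = A.
Proof.
apply/seteqP; split=> w.
  by move=> [u Au [_ -> <-]]; rewrite /cat_word cats0.
by move=> Aw; exists w => //; exists [::] => //; rewrite /cat_word cats0.
Qed.

Lemma wpow_shift A B r :
  wprod A (wpow (wprod B A) r) = wprod (wpow (wprod A B) r) A.
Proof.
elim: r => [|r IH] /=; first by rewrite wprodr1 wprod1.
by rewrite !wprodA IH.
Qed.

(* [okw] is stated without products of sets; both descriptions of the words
   with letters in Delta or P(Z) agree. *)
Lemma LambdaE Z w : Lambda X0 Z w <-> okw Z w.
Proof.
have HY v : X0 v -> [/\ okw Z v, endsP v = false & headP v = false].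
  by move=> /(X0_okw Z)[? /negPf-> /negPf->].
have HP v : Pset Z v -> [/\ okw Z v, endsP v = true & headP v = true].
  by move=> /Pset_okw.
have HYP := okw_wprod HY HP erefl; have HPY := okw_wprod HP HY erefl.
split.
  move=> [[[[r r0]|[r _]]|[r r0]]|[r _]].
  - by move=> /(okw_wpow HYP erefl r0)[].
  - by move=> /(okw_wpowprod HYP HY erefl)[].
  - by move=> /(okw_wpow HPY erefl r0)[].
  - by move=> /(okw_wpowprod HPY HP erefl)[].
set YP := wprod X0 (Pset Z); set PY := wprod (Pset Z) X0.
pose LY v := (exists2 r, (1 <= r)%N & wpow YP r v) \/
             (exists r, wprod (wpow YP r) X0 v).
pose LP v := (exists2 r, (1 <= r)%N & wpow PY r v) \/
             (exists r, wprod (wpow PY r) (Pset Z) v).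
suff H : okw Z w -> if headP w then LP w else LY w.
  move=> /H; case: ifP => _ [[r r1 Hr]|[r Hr]].
  - by left; right; exists r.
  - by right; exists r.
  - by left; left; left; exists r.
  - by left; left; right; exists r.
elim: w => [[]//|a w IH] [_ Paw Zaw].
have Za : okl Z a by apply: Zaw; rewrite inE eqxx.
have {}IH : w <> [::] -> if headP w then LP w else LY w.
  move=> w0; apply: IH; split=> //; first exact: path_sorted Paw.
  by move=> c cw; apply: Zaw; rewrite inE cw orbT.
case: Za => [Da|[z Zz ea]].
  have na := Delta_notP Da; rewrite /headP /= (negPf na).
  have Ya : X0 [:: a] by apply/X0E; split=> // c; rewrite inE => /eqP->.
  have [->|/eqP/IH] := eqVneq w [::].
    by right; exists 0%N; rewrite wprod1.
  case: ifP => _ [[r r1 Hr]|[r Hr]].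
  - by right; exists r; rewrite -wpow_shift; exists [:: a] => //; exists w.
  - left; exists r.+1 => //=; rewrite /YP wprodA wpow_shift.
    by exists [:: a] => //; exists w.
  - left; exists r => //; case: r r1 Hr => // r _ /=.
    rewrite /YP !wprodA => -[y Yy [v Hv <-]].
    by exists (cat_word [:: a] y); [exact: X0_cat|exists v].
  - right; exists r; case: r Hr => [|r].
      by rewrite wprod1 => Yw; exact: (X0_cat Ya Yw).
    rewrite /= /YP !wprodA => -[y Yy [v Hv <-]].
    by exists (cat_word [:: a] y); [exact: X0_cat|exists v].
have PPa : Pset Z [:: a] by exists z; rewrite ?ea.
rewrite /headP ea /= -ea.
have [->|/eqP] := eqVneq w [::].
  by right; exists 0%N; rewrite wprod1.
case: w Paw IH {Zaw} => // c w /= /andP[ac _] IH /IH.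
have -> : headP (c :: w) = false by move: ac; rewrite /headP /noPP ea /=; case: isP.
case=> [[r r1 Hr]|[r Hr]].
- by right; exists r; rewrite -wpow_shift; exists [:: a] => //; exists (c :: w).
- left; exists r.+1 => //=; rewrite /PY wprodA wpow_shift.
  by exists [:: a] => //; exists (c :: w).
Qed.

Lemma okw_sub Z Z' : Z `<=` Z' -> okw Z `<=` okw Z'.
Proof.
move=> ZZ w [w0 Pw Zw]; split=> // a /Zw[|[z /ZZ]]; first by left.
by right; exists z.
Qed.

Lemma Xn_le m n : (m <= n)%N -> @Xn X m `<=` @Xn X n.
Proof.
move=> mn; rewrite -(subnK mn); elim: (n - m)%N => // i IH w /IH {IH}.
rewrite addSn; elim: {mn}(i + m)%N w => [|p IH] w /=.
  by move=> X0w; apply/LambdaE; case: (X0_okw (@Xn X 0) X0w).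
by move=> /LambdaE ow; apply/LambdaE; apply: okw_sub ow.
Qed.

Lemma XinfE w : Xinf w <-> okw Xinf w.
Proof.
split=> [[[|n] _ /=]|].
- by move=> /(X0_okw Xinf)[].
- by move=> /LambdaE; apply: okw_sub => v Hv; exists n.
move=> [w0 PPw Zw].
suff [n Hn] : exists n, forall a, a \in w -> okl (@Xn X n) a.
  by exists n.+1 => //; apply/LambdaE.
elim: w Zw {w0 PPw} => [|a w IH] Zw; first by exists 0%N.
have [|n Hn] := IH; first by move=> c cw; apply: Zw; rewrite inE cw orbT.
have [m Hm] : exists m, okl (@Xn X m) a.
  have [Da|[z [m _ Hz] ->]] := Zw a (mem_head a w); first by exists 0%N; left.
  by exists m; right; exists z.
exists (maxn m n) => c; rewrite inE => /orP[/eqP->|/Hn].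
  case: Hm => [Da|[z Hz ->]]; [by left|right; exists z => //].
  by apply: Xn_le Hz; exact: leq_maxl.
case=> [Dc|[z Hz ->]]; [by left|right; exists z => //].
by apply: Xn_le Hz; exact: leq_maxr.
Qed.

Lemma depP_leq w n :
  (depP w <= n)%N = all (fun a => depP_letter a <= n)%N w.
Proof. by rewrite /depP; elim: w => //= a w <-; rewrite geq_max. Qed.

Lemma depP_Delta a : Delta [:: a] -> depP_letter a = 0%N.
Proof. by move=> /Delta_notP; case: a. Qed.

Lemma Xn_depP n w : Xinf w -> (@Xn X n w <-> (depP w <= n)%N).
Proof.
move=> Xw; split.
  elim: n w {Xw} => [|n IH] w /=; rewrite depP_leq.
    by move=> /X0E[_ Dw]; apply/allP=> a /Dw/depP_Delta->.
  move=> /LambdaE[_ _ Zw]; apply/allP=> a /Zw[/depP_Delta->//|[z /IH Hz ->]].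
  by rewrite /= ltnS.
elim: n w Xw => [|n IH] w /XinfE[w0 PPw Zw]; rewrite depP_leq => /allP dw /=.
  apply/X0E; split=> // a aw.
  by have := dw a aw; have [//|[z _ ->]] := Zw a aw.
apply/LambdaE; split=> // a aw.
have := dw a aw; have [|[z Xz ->] dz] := Zw a aw; first by left.
by right; exists z => //; apply: IH.
Qed.

Lemma Xinf_X0 w : X0 w -> Xinf w.
Proof. by exists 0%N. Qed.

Lemma Xinf_Pw w : Xinf (Pw w) <-> Xinf w.
Proof.
split=> [/XinfE[_ _ /(_ (Pbr w))]|Xw].
  rewrite inE eqxx => /(_ isT)[/Delta_notP //|[z Xz [->]] //].
by apply/XinfE; split=> // a; rewrite inE => /eqP->; right; exists w.
Qed.

Lemma Xinf_Gw (x : X) : Xinf (Gw x).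
Proof.
apply/Xinf_X0/X0E; split=> // a; rewrite inE => /eqP->.
by exists x, 0%N.
Qed.

Lemma flatten_std w : flatten (std w) = w.
Proof.
elim: w => //= a w IH; case: ifP => _ /=; first by rewrite IH.
by case: (std w) IH => [/= <-//|[|[x|s|s] s'] t] /= ->.
Qed.

Lemma std_eq0 w : std w = [::] -> w = [::].
Proof. by move=> sw; rewrite -(flatten_std w) sw. Qed.

Definition altb (s t : word X) : bool := headP s != headP t.

(* The blocks lie alternately in X0 and in P(Xinf). *)
Definition stdec (s : seq (word X)) : Prop :=
  (forall v, v \in s -> X0 v \/ Pset Xinf v) /\ sorted altb s.

Lemma std_consP a w : isP a -> std (a :: w) = [:: a] :: std w.
Proof. by move=> /= ->. Qed.

Lemma std_X0 u w : X0 u -> (w = [::] \/ headP w) ->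
  std (cat_word u w) = u :: std w.
Proof.
move=> X0u hw; have nP := X0_notP X0u; have /X0E[u0 _] := X0u.
elim: u u0 nP {X0u} => // a u IH _ nP /=.
have /negPf -> : ~~ isP a by apply: nP; rewrite inE eqxx.
have [->|/eqP u0] := eqVneq u [::].
  by case: hw => [-> //|]; case: w {IH} => // -[x|s|s] w //= _.
rewrite IH // => [|c cu]; last by apply: nP; rewrite inE cu orbT.
case: u u0 nP {IH} => // -[x|s|s] u // _ nP.
by have := nP (Pbr s); rewrite !inE eqxx orbT => /(_ isT).
Qed.

Lemma head_blockP v : X0 v \/ Pset Xinf v -> headP v -> Pset Xinf v.
Proof. by case=> // /(X0_okw Xinf)[_ _ /negPf->]. Qed.

Lemma head_blockN v : X0 v \/ Pset Xinf v -> ~~ headP v -> X0 v.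
Proof. by case=> // -[z _ <-]. Qed.

(* Any decomposition of this kind is the one computed by [std]. *)
Lemma std_unique s : stdec s -> std (flatten s) = s.
Proof.
elim: s => // v s IH [Bs As].
have {}IH : std (flatten s) = s.
  apply: IH; split; last exact: path_sorted As.
  by move=> u us; apply: Bs; rewrite inE us orbT.
have Bv := Bs v (mem_head _ _); rewrite [flatten _]/=.
case hv: (headP v).
  have [z _ <-] := head_blockP Bv hv.
  by rewrite [_ ++ _]/= std_consP // IH.
rewrite -[v ++ _]/(cat_word v (flatten s)) std_X0 ?IH //.
  by apply: head_blockN; rewrite ?hv.
case: s As Bs {IH} => [|u s] /=; first by left.
rewrite /altb hv; case hu: (headP u) => // _ Bs; right.
have [|z _ <-] := head_blockP _ hu => //.
by apply: Bs; rewrite !inE eqxx orbT.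
Qed.

Lemma std_alternating w : Xinf w -> stdec (std w).
Proof.
move=> /XinfE[w0 PPw Zw].
suff [? [? _]] : (forall v, v \in std w -> X0 v \/ Pset Xinf v) /\
    sorted altb (std w) /\ headP (head [::] (std w)) = headP w by split.
elim: w w0 PPw Zw => // a w IH _ PPw Zw.
have Za := Zw a (mem_head _ _).
have [->|/eqP w0] := eqVneq w [::].
  case: Za => [Da|[z Xz ->]] /=; last first.
    by split=> // v; rewrite inE => /eqP->; right; exists z.
  rewrite (negPf (Delta_notP Da)); split=> // v; rewrite inE => /eqP->; left.
  by apply/X0E; split=> // c; rewrite inE => /eqP->.
have {IH} [||Bw [Aw hw]] := IH w0.
- exact: path_sorted PPw.
- by move=> c cw; apply: Zw; rewrite inE cw orbT.
case: Za => [Da|[z Xz ea]]; last first.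
  rewrite std_consP ea //; split.
    by move=> v; rewrite inE => /orP[/eqP->|/Bw //]; right; exists z.
  have nw : headP w = false.
    case: w w0 PPw {hw Aw Zw Bw} => // c w _ /= /andP[ac _].
    by move: ac; rewrite ea /noPP /headP /=; case: isP.
  split=> //; move: Aw hw; rewrite nw.
  by case: (std w) => //= s t -> hw; rewrite /altb hw.
rewrite /= (negPf (Delta_notP Da)).
have Ya : X0 [:: a] by apply/X0E; split=> // c; rewrite inE => /eqP->.
case sw: (std w) Bw Aw hw => [|s t] Bw Aw hw; first by have := std_eq0 sw.
have Bs := Bw s (mem_head _ _).
have nP := negPf (Delta_notP Da).
case hs: (headP s).
  have -> : (if s is Pbr _ :: _ then [:: a] :: s :: t else (a :: s) :: t) =
    [:: a] :: s :: t by case: s hs {sw Bw Aw hw Bs} => // -[].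
  split; first by move=> v; rewrite inE => /orP[/eqP->|/Bw //]; left.
  split; last by rewrite /headP /= nP.
  by move: Aw => /= ->; rewrite /altb hs {1}/headP /= nP.
have -> : (if s is Pbr _ :: _ then [:: a] :: s :: t else (a :: s) :: t) =
  (a :: s) :: t by case: s hs {sw Bw Aw hw Bs} => // -[].
split.
  move=> v; rewrite inE => /orP[/eqP->|vt].
    left; apply: (X0_cat Ya); apply: head_blockN => //; by rewrite hs.
  by apply: Bw; rewrite inE vt orbT.
split; last by rewrite /headP /= nP.
by case: t Aw {Bw sw hw} => //= t0 t; rewrite /altb hs /headP /= nP.
Qed.
End WordTheory.

Section Spans.
Variables (k : comNzRingType) (X : Type).
Implicit Types (g h : {malg k[word X]}) (S : set (word X)) (u v w : word X).

Definition spanned S g : Prop := forall w, w \in msupp g -> S w.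

Lemma spanned0 S : spanned S 0.
Proof. by move=> w; rewrite msupp0 inE. Qed.

Lemma spannedD S g h : spanned S g -> spanned S h -> spanned S (g + h).
Proof.
move=> Sg Sh w /(fsubsetP (msuppD_le g h)).
by rewrite in_fsetU => /orP[/Sg|/Sh].
Qed.

Lemma spannedZ S (c : k) g : spanned S g -> spanned S (c *: g).
Proof. by move=> Sg w /(fsubsetP (msuppZ_le c g))/Sg. Qed.

Lemma spannedU S w : S w -> spanned S (<< w >> : {malg k[word X]}).
Proof. by move=> Sw v; rewrite msuppU1 in_fset1 => /eqP->. Qed.

Lemma spannedM S1 S2 g h : spanned S1 g -> spanned S2 h ->
  spanned (wprod S1 S2) (g * h).
Proof.
move=> S1g S2h w /msuppM_le[u [v [/S1g Su /S2h Sv ->]]].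
by exists u => //; exists v.
Qed.

Lemma spannedS S1 S2 g : S1 `<=` S2 -> spanned S1 g -> spanned S2 g.
Proof. by move=> S12 Sg w /Sg/S12. Qed.

Lemma spanned_lext S (f : word X -> {malg k[word X]}) g :
  (forall w, w \in msupp g -> spanned S (f w)) -> spanned S (lext f g).
Proof.
move=> Sf; rewrite /lext big_seq; elim/big_ind: _ => [|? ?|w wg].
- exact: spanned0.
- exact: spannedD.
- by apply: spannedZ; apply: Sf.
Qed.

Lemma lextEw (V : lmodType k) (f : word X -> V) g (d : {fset word X}) :
  (msupp g `<=` d)%fset -> lext f g = \sum_(w <- d) g@_w *: f w.
Proof.
move=> gd; rewrite /lext (big_fset_incl _ gd) // => w _ /mcoeff_outdom->.
by rewrite scale0r.
Qed.

Lemma lext_linear (V : lmodType k) (f : word X -> V) : linear (lext f).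
Proof.
move=> c g h; pose d := (msupp (c *: g + h) `|` msupp g `|` msupp h)%fset.
rewrite !(@lextEw _ _ _ d);
  try by apply/fsubsetP=> w wd; rewrite !in_fsetU wd ?orbT.
rewrite scaler_sumr -big_split /=; apply: eq_bigr => w _.
by rewrite mcoeffD mcoeffZ scalerDl scalerA.
Qed.

Lemma lextU (V : lmodType k) (f : word X -> V) w : lext f << w >> = f w.
Proof. by rewrite /lext msuppU1 big_seq_fset1 mcoeffUU scale1r. Qed.

Lemma mulUU u v :
  << u >> * << v >> = << cat_word u v >> :> {malg k[word X]}.
Proof. by rewrite malgM_def fgmulUU mulr1. Qed.

End Spans.

Section Recursions.
Variables (k : comNzRingType) (X : Type).
Implicit Types (u v w x y : word X) (s t : seq (word X)).

Local Notation kW := {malg k[word X]}.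
Local Notation diaw := (@diaw k X).

Lemma depP_block u x : x \in std u -> (depP x <= depP u)%N.
Proof.
move=> xu; rewrite depP_leq; apply/allP => a ax.
have /allP : all (fun c => depP_letter c <= depP u)%N u by rewrite -depP_leq.
apply.
by rewrite -(flatten_std u); apply/flattenP; exists x.
Qed.

Lemma depP_last u : (depP (last [::] (std u)) <= depP u)%N.
Proof.
by case su: (std u) => [|x s] //=; apply: depP_block; rewrite su mem_last.
Qed.

Lemma depP_head u : (depP (head [::] (std u)) <= depP u)%N.
Proof.
by case su: (std u) => [|x s] //=; apply: depP_block; rewrite su mem_head.
Qed.

Lemma dia_rec_fuel m n u v :
  (depP u + depP v < m)%N -> (depP u + depP v < n)%N ->
  dia_rec k m u v = dia_rec k n u v.
Proof.
elim: m n u v => // m IH [//|n] u v um un /=; rewrite /dia_step.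
have := leq_add (depP_last u) (depP_head v).
move: (last [::] (std u)) (head [::] (std v)) => x y xy.
suff -> : dia1 (dia_rec k m) x y = dia1 (dia_rec k n) x y by [].
have {um}xm := leq_ltn_trans xy um; have {un xy}xn := leq_ltn_trans xy un.
case: x xm xn => [|[x|x|x] [|? ?]] //; case: y => [|[y|y|y] [|? ?]] //.
rewrite /depP /= !maxn0 !addSn !addnS !ltnS => xm xn /=.
by congr (PW _ + PW _); apply: IH; rewrite /depP /= ?maxn0 ?addSn ?addnS;
  (exact: leq_trans xm _ || exact: leq_trans xn _).
Qed.

Lemma dia1_cat rec x y : ~~ (headP x && headP y) ->
  dia1 rec x y = << cat_word x y >> :> kW.
Proof.
by case: x => [|[x|x|x] [|? ?]] //; case: y => [|[y|y|y] [|? ?]].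
Qed.

Lemma diawE n u v : (depP u + depP v < n)%N -> diaw u v = dia_rec k n u v.
Proof. by move=> uv; apply: dia_rec_fuel. Qed.

Lemma diaw_breadth1 u v : breadth u = 1%N -> breadth v = 1%N ->
  ~~ (headP u && headP v) -> diaw u v = << cat_word u v >>.
Proof.
have b1 w : breadth w = 1%N -> std w = [:: w].
  rewrite /breadth => bw; case sw: (std w) bw => [|x []] // _.
  by have := flatten_std w; rewrite sw /= cats0 => ->.
move=> /b1 bu /b1 bv uv.
by rewrite /diaw /= /dia_step bu bv /= mul1r mulr1 dia1_cat.
Qed.

Lemma diaw_X0 u v : X0 u -> X0 v -> diaw u v = << cat_word u v >>.
Proof.
have b1 w : X0 w -> breadth w = 1%N.
  move=> X0w; rewrite /breadth -[w]cats0 -/(cat_word _ _) std_X0 //.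
  by left.
move=> Xu Xv; apply: diaw_breadth1; rewrite ?b1 //.
by have [_ _ /negPf->] := X0_okw Xinf Xu.
Qed.

Lemma diaw_PP u v :
  diaw (Pw u) (Pw v) = PW (diaw u (Pw v)) + PW (diaw (Pw u) v).
Proof.
rewrite {1}/diaw; set n := (_ + _)%N; rewrite /= /dia_step /= mul1r mulr1.
by rewrite !(@diawE n) // /n /depP /= ?maxn0 ?addSn ?addnS // ltnS leqnSn.
Qed.

Lemma diaw_std u v s x y t : Xinf u -> Xinf v ->
    std u = rcons s x -> std v = y :: t ->
  diaw u v = << flatten s : word X >> * diaw x y * << flatten t : word X >>.
Proof.
move=> Xu Xv su sv.
have b1 w z : Xinf w -> z \in std w -> std z = [:: z].
  move=> /std_alternating[Bw _] zw.
  rewrite -[in LHS](cats0 z) -[z ++ _]/(flatten [:: z]).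
  apply: std_unique; split=> // z'.
  by rewrite inE => /eqP->; apply: Bw.
have sx : std x = [:: x] by apply: (b1 u); rewrite // su mem_rcons mem_head.
have sy : std y = [:: y] by apply: (b1 v); rewrite // sv mem_head.
have xu : (depP x + depP y <= depP u + depP v)%N.
  by apply: leq_add; apply: depP_block; rewrite ?su ?sv ?mem_rcons mem_head.
rewrite (@diawE (depP u + depP v).+1 x y) ?ltnS // /diaw /= /dia_step.
rewrite su sv sx sy /= size_rcons /= mul1r mulr1 last_rcons.
by rewrite -cats1 take_size_cat.
Qed.

Variable b : k.
Local Notation dw := (@dw k X b).

Lemma dw_Delta w : Delta w -> dw w = << Dw w >>.
Proof.
by move=> /Delta_letter[[x|z|z] -> //] _; rewrite /dw /= mulr0 addr0 mulr1.
Qed.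

Lemma dw_cons a w : dw (a :: w) =
  d_letter b a * << w : word X >> + << [:: a] : word X >> * dw w.
Proof. by []. Qed.

Lemma dw_cat u v :
  dw (cat_word u v) = dw u * << v >> + << u >> * dw v.
Proof.
elim: u => [|a u IH]; first by rewrite /dw /= mul0r add0r mul1r.
rewrite [cat_word _ _]/= !dw_cons -/(cat_word u v) IH.
rewrite -[a :: u]/(cat_word [:: a] u) -(mulUU _ u v) -(mulUU _ [:: a] u).
by rewrite mulrDl mulrDr !mulrA addrA.
Qed.

Lemma dw_P w : dw (Pw w) = PW (dw w) + b *: << Pw w >>.
Proof. by rewrite /dw /= mulr0 addr0 mulr1. Qed.

End Recursions.

(* [diaw] and [dw] send words of Xinf to combinations of words of Xinf. *)
Section Closure.
Variables (k : comNzRingType) (X : Type).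
Implicit Types (u v w x y : word X) (a : letter X).

Local Notation kW := {malg k[word X]}.

(* Words of Xinf beginning (resp. ending) with P iff u (resp. v) does. *)
Definition ends_like u v : set (word X) :=
  [set w | [/\ Xinf w, headP w = headP u & endsP w = endsP v]].

Lemma noPPE w :
  sorted (@noPP X) w = sorted (fun p q : bool => ~~ (p && q)) (map (@isP X) w).
Proof. by rewrite sorted_map. Qed.

Lemma Xinf_cat u v : u <> [::] -> v <> [::] ->
  Xinf (cat_word u v) <-> [/\ Xinf u, Xinf v & ~~ (endsP u && headP v)].
Proof.
move=> u0 v0; split; last first.
  by move=> [/XinfE Xu /XinfE Xv uv]; apply/XinfE; apply: okw_cat.
move=> /XinfE[_ PPuv Zuv].
have [PPu PPv uv] : [/\ sorted (@noPP X) u, sorted (@noPP X) v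
    & ~~ (endsP u && headP v)].
  case: u v u0 v0 PPuv {Zuv} => [|a u] // [|c v] // _ _ /=.
  rewrite cat_path /= => /and3P[-> ac ->]; split=> //.
  by rewrite /endsP /headP /= last_map.
split=> //; apply/XinfE; split=> // a a_in; apply: Zuv.
  by rewrite mem_cat a_in.
by rewrite mem_cat a_in orbT.
Qed.

Lemma headP_cat u v : u <> [::] -> headP (cat_word u v) = headP u.
Proof. by case: u. Qed.

Lemma endsP_cat u v : v <> [::] -> endsP (cat_word u v) = endsP v.
Proof. by case: v => // c v _; rewrite /endsP map_cat last_cat. Qed.

Lemma Xinf_neq0 w : Xinf w -> w <> [::].
Proof. by move=> /XinfE[]. Qed.

Lemma cat_ends_like u1 x y v1 w : x <> [::] -> y <> [::] ->
  Xinf (cat_word u1 x) -> Xinf (cat_word y v1) -> ends_like x y w ->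
  ends_like (cat_word u1 x) (cat_word y v1) (cat_word (cat_word u1 w) v1).
Proof.
move=> x0 y0 Xu Xv [Xw hw ew]; have w0 := Xinf_neq0 Xw.
have [Xuw huw] : Xinf (cat_word u1 w) /\
    headP (cat_word u1 w) = headP (cat_word u1 x).
  have [->//|/eqP u10] := eqVneq u1 [::].
  move: Xu => /(Xinf_cat u10 x0)[Xu1 _ ux]; rewrite !headP_cat //.
  by split=> //; apply/(Xinf_cat u10 w0); rewrite hw.
have uw0 := Xinf_neq0 Xuw; have euw := endsP_cat u1 w0.
have [v1E|/eqP v10] := eqVneq v1 [::].
  by rewrite v1E /cat_word !cats0 -/(cat_word _ _); split; rewrite ?euw.
move: Xv => /(Xinf_cat y0 v10)[_ Xv1 yv].
split; last by rewrite !endsP_cat.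
  by apply/(Xinf_cat uw0 v10); rewrite euw ew.
by rewrite headP_cat.
Qed.

Lemma PW_ends_like u v (g : kW) : headP u -> endsP v ->
  spanned Xinf g -> spanned (ends_like u v) (PW g).
Proof.
move=> hu ev Xg; apply: spanned_lext => w /Xg Xw; apply: spannedU.
by split; rewrite ?hu ?ev //; apply/Xinf_Pw.
Qed.

Lemma dia_rec_closed n u v : Xinf u -> Xinf v ->
  spanned (ends_like u v) (dia_rec k n u v).
Proof.
elim: n u v => [|n IH] u v Xu Xv; first exact: spanned0.
rewrite [dia_rec _ _ _ _]/= /dia_step.
have [Bu _] := std_alternating Xu; have [Bv _] := std_alternating Xv.
case/lastP su: (std u) Bu => [|s x] Bu.
  by have := Xinf_neq0 Xu; rewrite (std_eq0 su).
case sv: (std v) Bv => [|y t] Bv.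
  by have := Xinf_neq0 Xv; rewrite (std_eq0 sv).
have Xb z : X0 z \/ Pset Xinf z -> Xinf z.
  by case=> [/Xinf_X0//|[z' Xz' <-]]; apply/Xinf_Pw.
have {}Bu : X0 x \/ Pset Xinf x by apply: Bu; rewrite mem_rcons mem_head.
have {}Bv : X0 y \/ Pset Xinf y by apply: Bv; rewrite mem_head.
have Xx := Xb _ _ Bu; have Xy := Xb _ _ Bv.
rewrite last_rcons size_rcons /= -cats1 take_size_cat //.
have eu : u = cat_word (flatten s) x.
  by rewrite -[LHS]flatten_std su flatten_rcons.
have ev : v = cat_word y (flatten t) by rewrite -[LHS]flatten_std sv.
suff H : spanned (ends_like x y) (dia1 (dia_rec k n) x y).
  have := spannedM (spannedM (@spannedU k X [set flatten s] _ erefl) H)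
                   (@spannedU k X [set flatten t] _ erefl).
  apply: spannedS => _ [_ [_ -> [w Hw <-]] [_ -> <-]].
  rewrite eu ev; apply: cat_ends_like => //; rewrite -?eu -?ev //;
    exact: Xinf_neq0.
have [/andP[hx hy]|nP] := boolP (headP x && headP y); last first.
  rewrite dia1_cat //; apply: spannedU.
  have [x0 y0] := (Xinf_neq0 Xx, Xinf_neq0 Xy).
  have ex : endsP x = headP x.
    by case: Bu => [/(X0_okw Xinf)[_ /negPf-> /negPf->]|[z _ <-]].
  by split; rewrite ?headP_cat ?endsP_cat //; apply/Xinf_cat; rewrite ?ex.
have [z Xz ex] := head_blockP Bu hx; have [z' Xz' ey] := head_blockP Bv hy.
rewrite -ex -ey in Xx Xy *; rewrite /dia1 /=.
apply: spannedD; apply: PW_ends_like => //.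
  by apply: spannedS (IH _ _ Xz Xy) => w [].
by apply: spannedS (IH _ _ Xx Xz') => w [].
Qed.

Lemma diaw_closed u v : Xinf u -> Xinf v -> spanned Xinf (diaw k u v).
Proof.
by move=> Xu Xv; apply: spannedS (dia_rec_closed Xu Xv) => w [].
Qed.

Lemma dw_like (b : k) w : (forall a, a \in w ->
    spanned [set v | exists c, [/\ v = [:: c], okl Xinf c & isP c = isP a]]
      (d_letter b a)) ->
  (forall a, a \in w -> okl Xinf a) ->
  spanned [set v | map (@isP X) v = map (@isP X) w /\
                   (forall a, a \in v -> okl Xinf a)] (dw b w).
Proof.
elim: w => [|a w IH] Ha Zw; first exact: spanned0.
rewrite dw_cons; apply: spannedD.
  have := spannedM (Ha a (mem_head _ _)) (@spannedU k X [set w] _ erefl).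
  apply: spannedS => _ [_ [c [-> Zc ca]] [_ -> <-]]; split=> /=.
    by rewrite ca.
  by move=> a'; rewrite inE => /orP[/eqP->//|a'w]; apply: Zw; rewrite inE a'w orbT.
have := spannedM (@spannedU k X [set [:: a]] _ erefl)
  (IH (fun c cw => Ha c (mem_behead (s := a :: w) cw))
      (fun c cw => Zw c (mem_behead (s := a :: w) cw))).
apply: spannedS => _ [_ -> [v [vw Zv] <-]]; split=> /=; first by rewrite vw.
move=> a'; rewrite inE => /orP[/eqP->|/Zv//].
by apply: Zw; exact: mem_head.
Qed.

Lemma dw_closed (b : k) w : Xinf w -> spanned Xinf (dw b w).
Proof.
move=> Xw; have [n] := ubnP (depP w); elim: n w Xw => // n IH w Xw dn.
have /XinfE[w0 PPw Zw] := Xw.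
apply: (spannedS _ (dw_like _ Zw)) => [v [vw Zv]|a aw].
  apply/XinfE; split=> //; last by rewrite noPPE vw -noPPE.
  by move=> v0; case: (w) w0 vw => //; rewrite v0.
have [Da|[z Xz ea]] := Zw a aw.
  have da : d_letter b a = << Dw [:: a] >>.
    by have /Delta_notP := Da; case: (a).
  rewrite da; apply: spannedU; exists (Dbr [:: a]).
  split=> //; last by rewrite (negPf (Delta_notP Da)).
  by left; have [x [m ->]] := Da; exists x, m.+1.
rewrite ea /=; apply: spannedD; last first.
  by apply: spannedZ; apply: spannedU; exists (Pbr z); split=> //; right; exists z.
apply: spanned_lext => v vz; apply: spannedU; exists (Pbr v); split=> //.
right; exists v => //; apply: (IH z) vz => //.
have /allP/(_ a aw) : all (fun c => depP_letter c <= depP w)%N w.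
  by rewrite -depP_leq.
by rewrite ea /= => zw; apply: leq_trans zw _.
Qed.

End Closure.

Section FreeObject.
Variables (k : comNzRingType) (X : Type).

(* The free module on Xinf is taken to be the submodule of the free module on
   all words spanned by Xinf. *)
Definition in_kXinf : {pred {malg k[word X]}} :=
  fun g => `[< spanned Xinf g >].

Lemma in_kXinfP g : reflect (spanned Xinf g) (g \in in_kXinf).
Proof. exact: asboolP. Qed.

Lemma in_kXinf_submod : submod_closed in_kXinf.
Proof.
split=> [|c g h /in_kXinfP Xg /in_kXinfP Xh]; apply/in_kXinfP.
  exact: spanned0.
by apply: spannedD => //; apply: spannedZ.
Qed.

HB.instance Definition _ := GRing.isSubmodClosed.Build k {malg k[word X]}
  in_kXinf in_kXinf_submod.

Record kXinf : Type := KXinf { kXval : {malg k[word X]}; _ : kXval \in in_kXinf }.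

HB.instance Definition _ := [isSub for kXval].
HB.instance Definition _ := [Choice of kXinf by <:].
HB.instance Definition _ := [SubChoice_isSubLmodule of kXinf by <:].

Lemma kXvalP (f : kXinf) : spanned Xinf (kXval f).
Proof. by apply/in_kXinfP; case: f. Qed.

Lemma wordX_subproof (w : word X) : Xinf w -> << w >> \in in_kXinf.
Proof. by move=> Xw; apply/in_kXinfP; apply: spannedU. Qed.

Definition wordX (w : word X) (Xw : Xinf w) : kXinf := KXinf (wordX_subproof Xw).

Definition jX (x : X) : kXinf := wordX (Xinf_Gw x).

Lemma diaX_subproof (f g : kXinf) : diaW (kXval f) (kXval g) \in in_kXinf.
Proof.
apply/in_kXinfP; apply: spanned_lext => u /kXvalP Xu.
by apply: spanned_lext => v /kXvalP Xv; apply: diaw_closed.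
Qed.

Definition diaX (f g : kXinf) : kXinf := KXinf (diaX_subproof f g).

Lemma PX_subproof (f : kXinf) : PW (kXval f) \in in_kXinf.
Proof.
apply/in_kXinfP; apply: spanned_lext => u /kXvalP Xu.
by apply: spannedU; apply/Xinf_Pw.
Qed.

Definition PX (f : kXinf) : kXinf := KXinf (PX_subproof f).

Variable b : k.

Lemma dX_subproof (f : kXinf) : dW b (kXval f) \in in_kXinf.
Proof.
by apply/in_kXinfP; apply: spanned_lext => u /kXvalP Xu; apply: dw_closed.
Qed.

Definition dX (f : kXinf) : kXinf := KXinf (dX_subproof f).

End FreeObject.

Section ParaDifferential.
Variable k : comNzRingType.

(* Associative algebras, without assuming an identity element: Xinf consists
   of nonempty words, so its span has no identity unless X is empty. *)
Definition is_algebra (A : lmodType k) (mul : A -> A -> A) : Prop :=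
  [/\ associative mul,
      forall y, linear (mul^~ y)
    & forall x, linear (mul x)].

(* The condition on identity elements is vacuous when there is none. *)
Definition is_differential (A : lmodType k) (mul : A -> A -> A) (d : A -> A) :
    Prop :=
  [/\ linear d,
      forall x y, d (mul x y) = mul (d x) y + mul x (d y)
    & forall e, left_id e mul -> right_id e mul -> d e = 0].

Definition is_Rota_Baxter (A : lmodType k) (mul : A -> A -> A) (P : A -> A) :
    Prop :=
  [/\ linear P
    & forall x y, mul (P x) (P y) = P (mul (P x) y) + P (mul x (P y))].

Definition is_paradiffRB3 (b : k) (A : lmodType k) (mul : A -> A -> A)
    (d P : A -> A) : Prop :=
  [/\ is_algebra mul, is_differential mul d, is_Rota_Baxter mul P
    & forall x, d (P x) = P (d x) + b *: P x].

Definition is_alg_hom (A B : lmodType k) (mulA : A -> A -> A)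
    (mulB : B -> B -> B) (f : A -> B) : Prop :=
  [/\ linear f & forall x y, f (mulA x y) = mulB (f x) (f y)].

End ParaDifferential.

(* Main.v *)
Require Import Defs.
From mathcomp Require Import all_boot all_order all_algebra finmap monalg.
From mathcomp Require Import boolp classical_sets.

Set Implicit Arguments.
Unset Strict Implicit.
Unset Printing Implicit Defensive.

Import GRing.Theory.
Local Open Scope classical_set_scope.
Local Open Scope ring_scope.

(** The free module kW on all bracketed words, empty word and adjacent
    P-brackets included, is itself an algebra for the extension of the product:
    the empty word is a unit, and the product of two nonempty words
    concatenates everything except their two meeting letters,
<<
      (u a) . (c v) = u (a . c) v,
>>
    where a . c is the word a c unless both letters are P-brackets, in which
    case it is given by the Rota-Baxter rule ([diaw_rcons_cons]).  Working on
    kW rather than on the span of Xinf avoids any bookkeeping of alternation.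

    Because of this shape, associativity and the Leibniz rule need to be
    checked on letters only ([local_assoc], [local_assoc_letter],
    [local_Leibniz]).  On letters which are not all P-brackets they are
    immediate.  On P-brackets, expanding both sides by the Rota-Baxter rule
    (and by d P = P d + b P) leads to the same identities for words of smaller
    total P-depth ([RotaBaxter_assoc_step], [RotaBaxter_Leibniz_step]), so that
    induction on the P-depth concludes.  In the Leibniz rule the terms in b
    agree because each of the two summands P(x P(y)) and P(P(x) y) of
    P(x) P(y) receives 2b on both sides: on the left, one b from the outer P
    and one from the inner P; on the right, one b from each factor.
    The structure on the span of Xinf is obtained by restriction.

    For the universal property, a map f from X to R extends to words by
    evaluating brackets with d and P and concatenation with the product of R.
    Each of the defining recursions of d and of the product is an identity
    valid in R, so evaluation is a morphism ([eval_dW], [eval_diaW]).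
    Conversely every word of Xinf is obtained from generators by d, P and
    products of words whose product is plain concatenation, so a morphism is
    determined by its values on X ([hom_wordX], [hom_evalE]). *)

(** * Reduction of linear identities to words *)

Section Linearity.
Variables (k : comNzRingType) (X : Type).
Implicit Types (u v w : word X) (S : set (word X)).
Local Notation kW := {malg k[word X]}.
Implicit Types (f g h : kW).

Lemma malg_spanE g : g = \sum_(w <- msupp g) g@_w *: << w >>.
Proof.
rewrite [LHS]monalgE; apply: eq_bigr => w _.
by apply/malgP=> v; rewrite mcoeffZ !mcoeffU mulr_natr.
Qed.

Lemma linear_lincomb (V W : lmodType k) (F : V -> W) (I : eqType) (s : seq I)
    (c : I -> k) (G : I -> V) : linear F ->
  F (\sum_(i <- s) c i *: G i) = \sum_(i <- s) c i *: F (G i).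
Proof.
move=> linF.
have F0 : F 0 = 0 by have := linF (-1) 0 0; rewrite scaler0 addr0 scaleN1r addNr.
elim: s => [|i s IH]; first by rewrite !big_nil.
by rewrite !big_cons linF IH.
Qed.

(** Every multilinear identity below is reduced to words by this lemma, one
    variable at a time. *)
Lemma eq_linear_spanned S (V : lmodType k) (F G : kW -> V) :
  linear F -> linear G -> (forall w, S w -> F << w >> = G << w >>) ->
  forall g, spanned S g -> F g = G g.
Proof.
move=> linF linG FG g Sg; rewrite [g]malg_spanE !linear_lincomb //.
by rewrite big_seq [RHS]big_seq; apply: eq_bigr => w /Sg/FG ->.
Qed.

Lemma eq_linear (V : lmodType k) (F G : kW -> V) :
  linear F -> linear G -> (forall w, F << w >> = G << w >>) -> F =1 G.
Proof.
by move=> linF linG FG g; apply: (@eq_linear_spanned setT) => // w _; apply: FG.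
Qed.

Lemma malg1E : 1 = << [::] >> :> kW. Proof. by []. Qed.

Lemma malg_mulrZ c g h : g * (c *: h) = c *: (g * h).
Proof.
rewrite (malgMEw (fsubset_refl (msupp g)) (msuppZ_le c h)) malgME !scaler_sumr.
apply: eq_bigr => u _; rewrite scaler_sumr; apply: eq_bigr => v _.
by apply/malgP=> w; rewrite mcoeffZ !mcoeffU mcoeffZ mulrnAr mulrCA.
Qed.

Lemma malg_mul_linl c f g h : (c *: f + g) * h = c *: (f * h) + g * h.
Proof. by rewrite mulrDl scalerAl. Qed.

Lemma malg_mul_linr c f g h : f * (c *: g + h) = c *: (f * g) + f * h.
Proof. by rewrite mulrDr malg_mulrZ. Qed.

Lemma PW_lin c g h : PW (c *: g + h) = c *: PW g + PW h.
Proof. exact: lext_linear. Qed.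

Lemma dW_lin (b : k) c g h : dW b (c *: g + h) = c *: dW b g + dW b h.
Proof. exact: lext_linear. Qed.

Lemma diaW_linl c f g h : diaW (c *: f + g) h = c *: diaW f h + diaW g h.
Proof. exact: lext_linear. Qed.

Lemma diaW_linr c f g h : diaW f (c *: g + h) = c *: diaW f g + diaW f h.
Proof.
rewrite /diaW {1 3 4}/lext scaler_sumr -big_split; apply: eq_bigr => u _ /=.
by rewrite lext_linear scalerDr !scalerA mulrC.
Qed.

Lemma PWU w : PW << w >> = << Pw w >> :> kW.
Proof. exact: lextU. Qed.

Lemma dWU (b : k) w : dW b << w >> = dw b w.
Proof. exact: lextU. Qed.

Lemma diaWU u v : diaW << u >> << v >> = diaw k u v.
Proof. by rewrite /diaW !lextU. Qed.

Lemma PWD g h : PW (g + h) = PW g + PW h.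
Proof. by have := PW_lin 1 g h; rewrite !scale1r. Qed.

Lemma PWZ c g : PW (c *: g) = c *: PW g.
Proof. by have := PW_lin c g 0; rewrite /PW /lext msupp0 big_seq_fset0 !addr0. Qed.

Lemma diaWDl f g h : diaW (f + g) h = diaW f h + diaW g h.
Proof. by have := diaW_linl 1 f g h; rewrite !scale1r. Qed.

Lemma diaWDr f g h : diaW f (g + h) = diaW f g + diaW f h.
Proof. by have := diaW_linr 1 f g h; rewrite !scale1r. Qed.

Lemma diaW0l g : diaW 0 g = 0.
Proof. by rewrite /diaW /lext msupp0 big_seq_fset0. Qed.

Lemma diaW0r g : diaW g 0 = 0.
Proof. by have := diaW_linr (-1) g 0 0; rewrite scaler0 addr0 scaleN1r addNr. Qed.

Lemma diaWZl c g h : diaW (c *: g) h = c *: diaW g h.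
Proof. by have := diaW_linl c g 0 h; rewrite diaW0l !addr0. Qed.

Lemma diaWZr c g h : diaW g (c *: h) = c *: diaW g h.
Proof. by have := diaW_linr c g h 0; rewrite diaW0r !addr0. Qed.

Lemma dWD (b : k) g h : dW b (g + h) = dW b g + dW b h.
Proof. by have := dW_lin b 1 g h; rewrite !scale1r. Qed.
End Linearity.

(** * The product of bracketed words *)

Section WordProduct.
Variables (k : comNzRingType) (X : Type).
Implicit Types (u v w : word X) (a c e : letter X) (S : set (word X)).
Local Notation kW := {malg k[word X]}.
Implicit Types (f g h : kW).

Lemma isP_Pbr a : isP a -> exists z, a = Pbr z.
Proof. by case: a => // z _; exists z. Qed.

Lemma std_rcons_Pbr u z : std (rcons u (Pbr z)) = rcons (std u) [:: Pbr z].
Proof.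
elim: u => //= a u ->; case: ifP => // _.
by case: (std u) => [|[|[x|x|x] s] t].
Qed.

Lemma headP_last_std u a : ~~ isP a ->
  headP (last [::] (std (rcons u a))) = false.
Proof.
move=> aP; elim: u => [|c u] /=; first by rewrite (negPf aP) /headP /= (negPf aP).
case: (std (rcons u a)) (@std_eq0 _ (rcons u a)) => [|s t] nil_u.
  by have := nil_u erefl; case: (u).
case: ifP => //= cP; case: t {nil_u} => [|s' t]; last by case: s => [|[x|x|x] s].
by case: s => [|[x|x|x] s] //=; rewrite /headP /= cP.
Qed.

Lemma headP_head_std w : headP (head [::] (std w)) = headP w.
Proof.
case: w => //= a w; case: ifP => //= aP.
by case: (std w) => [|[|[x|x|x] s] t].
Qed.

Lemma flatten_std_last w :
  cat_word (flatten (take (size (std w)).-1 (std w))) (last [::] (std w)) = w.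
Proof.
rewrite -[RHS]flatten_std; case/lastP: (std w) => [|s x] //.
by rewrite size_rcons last_rcons -cats1 take_size_cat // flatten_cat /= cats0.
Qed.

Lemma flatten_std_head w :
  cat_word (head [::] (std w)) (flatten (behead (std w))) = w.
Proof. by rewrite -[RHS]flatten_std; case: (std w). Qed.

(** The blocks of a standard decomposition are single P-brackets or runs
    without P-brackets, so the last block starts with a P-bracket exactly when
    the word ends with one. *)
Lemma headP_last_stdE u : headP (last [::] (std u)) = endsP u.
Proof.
case/lastP: u => [//|u a]; rewrite /endsP map_rcons last_rcons.
have [aP|aP] := boolP (isP a); last by rewrite headP_last_std.
by case: a aP => // z _; rewrite std_rcons_Pbr last_rcons.
Qed.

(** The defining recursion cuts words into blocks; cutting into letters gives
    the same product, since only the meeting letters matter.  This holds for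
    arbitrary words, in particular when one of them is empty. *)
Lemma diaw_cat u v : ~~ (endsP u && headP v) ->
  diaw k u v = << cat_word u v >>.
Proof.
move=> uv; rewrite /diaw /= /dia_step dia1_cat; last first.
  by rewrite headP_last_stdE headP_head_std.
by rewrite !mulUU cat_wordA flatten_std_last -cat_wordA flatten_std_head.
Qed.

Lemma diaw_rcons_cons u a c v :
  diaw k (rcons u a) (c :: v) = << u >> * diaw k [:: a] [:: c] * << v >>.
Proof.
have [/andP[/isP_Pbr[x ->] /isP_Pbr[y ->]]|ac] := boolP (isP a && isP c); last first.
  rewrite !diaw_cat ?mulUU //; last by rewrite /endsP map_rcons last_rcons.
  by rewrite /cat_word -cats1 -!catA.
(* The two sides unfold the same recursion with different bounds. *)
rewrite /diaw [in RHS](@dia_rec_fuel _ _ _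
  (depP (rcons u (Pbr x)) + depP (Pbr y :: v)).+1) //; last first.
  rewrite ltnS leq_add // depP_leq; apply/allP => d; rewrite inE => /eqP->;
    move: (leqnn (depP (rcons u (Pbr x)))) (leqnn (depP (Pbr y :: v)));
    rewrite !depP_leq => /allP Hx /allP Hy.
    by apply: Hx; rewrite mem_rcons mem_head.
  by apply: Hy; rewrite mem_head.
rewrite [LHS]/= [X in _ = _ * X * _]/= /dia_step std_rcons_Pbr /= mul1r mulr1.
by rewrite size_rcons last_rcons /= -cats1 take_size_cat // !flatten_std.
Qed.

Lemma diaw0w v : diaw k [::] v = << v >>.
Proof. by rewrite diaw_cat. Qed.

Lemma diaww0 u : diaw k u [::] = << u >>.
Proof. by rewrite diaw_cat /cat_word ?cats0 // andbF. Qed.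

Definition nonnil : set (word X) := [set w | w <> [::]].

(** Words glued to the far ends of the factors pass through the product.  The
    inner factors must be nonempty: otherwise g and h would meet. *)
Lemma diaW_mul g h A C : spanned nonnil A -> spanned nonnil C ->
  diaW (g * A) (C * h) = g * diaW A C * h.
Proof.
move=> nA nC.
move: g; apply: eq_linear => [c x y|c x y|u];
  [by rewrite !malg_mul_linl diaW_linl|by rewrite !malg_mul_linl|].
move: h; apply: eq_linear => [c x y|c x y|v];
  [by rewrite !malg_mul_linr diaW_linr|by rewrite malg_mul_linr|].
move: A nA; apply: eq_linear_spanned => [c x y|c x y|x nx];
  [by rewrite malg_mul_linr diaW_linl|by rewrite diaW_linl malg_mul_linr malg_mul_linl|].
move: C nC; apply: eq_linear_spanned => [c z y|c z y|y ny];
  [by rewrite malg_mul_linl diaW_linr|by rewrite diaW_linr malg_mul_linr malg_mul_linl|].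
case/lastP: x nx => // x a _; case: y ny => // c y _.
rewrite !mulUU !diaWU /cat_word -rcons_cat cat_cons !diaw_rcons_cons.
rewrite -/(cat_word u x) -/(cat_word y v) -(mulUU k u x) -(mulUU k y v).
have mulA5 (p q r s t : kW) : p * q * r * (s * t) = p * (q * r * s) * t.
  by rewrite !mulrA.
exact: mulA5.
Qed.

Lemma diaW1l g : diaW 1 g = g.
Proof.
move: g; apply: eq_linear => [c x y|c x y|u];
  [by rewrite diaW_linr|by []|].
by rewrite malg1E diaWU diaw0w.
Qed.

Lemma diaW1r g : diaW g 1 = g.
Proof.
move: g; apply: eq_linear => [c x y|c x y|u];
  [by rewrite diaW_linl|by []|].
by rewrite malg1E diaWU diaww0.
Qed.

Lemma diaW_mull g A C : spanned nonnil A -> spanned nonnil C ->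
  diaW (g * A) C = g * diaW A C.
Proof. by move=> nA nC; have := diaW_mul g 1 nA nC; rewrite !mulr1. Qed.

Lemma diaW_mulr h A C : spanned nonnil A -> spanned nonnil C ->
  diaW A (C * h) = diaW A C * h.
Proof. by move=> nA nC; have := diaW_mul 1 h nA nC; rewrite !mul1r. Qed.

Lemma diaW_PW f g :
  diaW (PW f) (PW g) = PW (diaW f (PW g)) + PW (diaW (PW f) g).
Proof.
move: f; apply: eq_linear => [c x y|c x y|u];
  [by rewrite PW_lin diaW_linl|by rewrite !(PW_lin, diaW_linl) scalerDr addrACA|].
move: g; apply: eq_linear => [c x y|c x y|v];
  [by rewrite PW_lin diaW_linr|by rewrite !(PW_lin, diaW_linr) scalerDr addrACA|].
by rewrite !PWU !diaWU diaw_PP.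
Qed.

(** The words consisting of a single P-bracket: they behave like one letter,
    which is why a product of two P-brackets can again be treated as one. *)
Definition bracketP : set (word X) := [set w | exists z, w = Pw z].

Lemma PW_bracketP g : spanned bracketP (PW g).
Proof. by apply: spanned_lext => w _; apply: spannedU; exists w. Qed.

Lemma bracketP_nonnil : bracketP `<=` nonnil.
Proof. by move=> _ [z ->]. Qed.

Lemma diaw_letter_nonnil a c : spanned nonnil (diaw k [:: a] [:: c]).
Proof.
have [/andP[/isP_Pbr[x ->] /isP_Pbr[y ->]]|ac] := boolP (isP a && isP c); last first.
  by rewrite diaw_cat //; apply: spannedU.
rewrite diaw_PP -PWD.
by apply: spannedS (@PW_bracketP _) => w; apply: bracketP_nonnil.
Qed.

End WordProduct.

(** * From letters to words

    Here m is an arbitrary operation on a ring whose own product plays the part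
    of concatenation. *)

Section ConcatenationSteps.
Variables (V : nzRingType) (m : V -> V -> V) (d : V -> V).

(** Locality at a junction: m leaves the outer factors alone when x and y
    meet. *)
Definition local_at x y := forall u w, m (u * x) (y * w) = u * m x y * w.

(** When the middle factor has two distinct ends y and z, the two products act
    at disjoint places and commute. *)
Lemma local_assoc u x y v z t w : local_at x y -> local_at z t ->
  m (m (u * x) (y * (v * z))) (t * w) = m (u * x) (m (y * (v * z)) (t * w)).
Proof.
move=> xy zt; rewrite xy mulrA zt [y * (v * z)]mulrA zt.
by rewrite -2!(mulrA y) xy !mulrA.
Qed.

(** When the middle factor is a single letter y, both junctions involve it and
    associativity has to be known for x, y, z. *)
Lemma local_assoc_letter u x y z w : local_at x y -> local_at y z ->
  local_at (m x y) z -> local_at x (m y z) -> m (m x y) z = m x (m y z) ->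
  m (m (u * x) y) (z * w) = m (u * x) (m y (z * w)).
Proof.
move=> xy yz xyz xyz' xA.
have -> : m (u * x) y = u * m x y by have := xy u 1; rewrite !mulr1.
have -> : m y (z * w) = m y z * w by have := yz 1 w; rewrite !mul1r.
by rewrite xyz xyz' xA.
Qed.

Hypothesis mDl : forall x y z, m (x + y) z = m x z + m y z.
Hypothesis mDr : forall x y z, m x (y + z) = m x y + m x z.
Hypothesis dM : forall x y, d (x * y) = d x * y + x * d y.

Lemma local_Leibniz u x y w :
  local_at x y -> local_at (d x) y -> local_at x (d y) ->
  d (m x y) = m (d x) y + m x (d y) ->
  d (m (u * x) (y * w)) = m (d (u * x)) (y * w) + m (u * x) (d (y * w)).
Proof.
move=> xy dxy xdy L.
by rewrite xy !dM mDl mDr !xy dxy xdy L mulrDr !mulrDl !addrA.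
Qed.
End ConcatenationSteps.

(** * Inductive steps on P-brackets *)

Section RotaBaxterSteps.
Variables (k : pzRingType) (V : lmodType k) (m : V -> V -> V) (P d : V -> V).
Hypothesis mDl : forall x y z, m (x + y) z = m x z + m y z.
Hypothesis mDr : forall x y z, m x (y + z) = m x y + m x z.
Hypothesis PD : forall x y, P (x + y) = P x + P y.
Hypothesis RB : forall x y, m (P x) (P y) = P (m x (P y)) + P (m (P x) y).

(** Both sides expand to P of the sum of the three products of P(x), P(y),
    P(z) in which one P has been removed.  Hence associativity for the three
    smaller triples suffices. *)
Lemma RotaBaxter_assoc_step x y z :
  m (m x (P y)) (P z) = m x (m (P y) (P z)) ->
  m (m (P x) y) (P z) = m (P x) (m y (P z)) ->
  m (m (P x) (P y)) z = m (P x) (m (P y) z) ->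
  m (m (P x) (P y)) (P z) = m (P x) (m (P y) (P z)).
Proof.
move=> xA yA zA.
have -> : m (m (P x) (P y)) (P z) =
    P (m (m x (P y)) (P z) + m (m (P x) y) (P z) + m (m (P x) (P y)) z).
  by rewrite RB !mDl !RB !PD addrACA.
have -> : m (P x) (m (P y) (P z)) =
    P (m x (m (P y) (P z)) + m (P x) (m y (P z)) + m (P x) (m (P y) z)).
  by rewrite (RB y z) !mDr !RB !PD addrACA -!addrA.
by rewrite xA yA zA.
Qed.

Variable b : k.
Hypothesis mZl : forall c x y, m (c *: x) y = c *: m x y.
Hypothesis mZr : forall c x y, m x (c *: y) = c *: m x y.
Hypothesis PZ : forall c x, P (c *: x) = c *: P x.
Hypothesis dD : forall x y, d (x + y) = d x + d y.
Hypothesis dP : forall x, d (P x) = P (d x) + b *: P x.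

(** The scalar b appears twice on each of P(x P(y)) and P(P(x) y), on both
    sides, as explained at the top. *)
Lemma RotaBaxter_Leibniz_step x y :
  d (m x (P y)) = m (d x) (P y) + m x (d (P y)) ->
  d (m (P x) y) = m (d (P x)) y + m (P x) (d y) ->
  d (m (P x) (P y)) = m (d (P x)) (P y) + m (P x) (d (P y)).
Proof.
move=> dx dy; rewrite RB dD !dP dx dy !dP.
rewrite !(mDl, mDr) !(mZl, mZr) !RB !PD !PZ !scalerDr.
(* The left side lists the four terms without b and twice each of the two
   terms in b, grouped by the summand of P(x) P(y) from which they arise; the
   right side groups them by the factor which is differentiated. *)
by rewrite [LHS]((+%R).[AC (1*2*1*4) ((1*5)*(3*6)*((2*7)*(4*8)))]).
Qed.
End RotaBaxterSteps.

(** * The algebra on all bracketed words *)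

Section WordAlgebra.
Variables (k : comNzRingType) (X : Type).
Implicit Types (u v w : word X) (a c e : letter X) (S : set (word X)).
Local Notation kW := {malg k[word X]}.
Local Notation U w := (<< (w : word X) >> : kW).
Local Notation diaW := (@diaW k X).
Implicit Types (f g h : kW).

Lemma malg_cons a u : U (a :: u) = U [:: a] * U u.
Proof. by rewrite mulUU. Qed.

Lemma malg_rcons u a : U (rcons u a) = U u * U [:: a].
Proof. by rewrite mulUU /cat_word cats1. Qed.

Lemma depP_Pw u : depP (Pw u) = (depP u).+1.
Proof. by rewrite /depP /= maxn0. Qed.

Lemma depP_mem u a : a \in u -> (depP_letter a <= depP u)%N.
Proof.
by move=> au; have := leqnn (depP u); rewrite {1}depP_leq => /allP; apply.
Qed.

Lemma depP_letterE a : depP [:: a] = depP_letter a.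
Proof. exact: maxn0. Qed.

Lemma diaW_letterN a c : ~~ (isP a && isP c) ->
  diaW (U [:: a]) (U [:: c]) = U [:: a] * U [:: c].
Proof. by move=> ac; rewrite diaWU diaw_cat // mulUU. Qed.

Lemma diaW_letter_PW a g : ~~ isP a ->
  diaW (U [:: a]) (PW g) = U [:: a] * PW g.
Proof.
move=> aP; move: g; apply: eq_linear => [c x y|c x y|u];
  [by rewrite PW_lin diaW_linr|by rewrite PW_lin malg_mul_linr|].
by rewrite PWU diaW_letterN // (negPf aP).
Qed.

Lemma diaW_PW_letter a g : ~~ isP a ->
  diaW (PW g) (U [:: a]) = PW g * U [:: a].
Proof.
move=> aP; move: g; apply: eq_linear => [c x y|c x y|u];
  [by rewrite PW_lin diaW_linl|by rewrite PW_lin malg_mul_linl|].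
by rewrite PWU diaW_letterN // (negPf aP) andbF.
Qed.

(** If one of the three letters is not a P-bracket, at most one of the two
    junctions is not a concatenation. *)
Lemma diaW_letterA_nonPPP a c e : ~~ [&& isP a, isP c & isP e] ->
  diaW (diaW (U [:: a]) (U [:: c])) (U [:: e]) =
  diaW (U [:: a]) (diaW (U [:: c]) (U [:: e])).
Proof.
have sp a' : spanned (@nonnil X) (U [:: a']) by apply: spannedU.
move=> ace.
have [/andP[aP cP]|ac] := boolP (isP a && isP c).
  have eP : ~~ isP e by move: ace; rewrite aP cP.
  have ce : ~~ (isP c && isP e) by rewrite (negPf eP) andbF.
  rewrite (diaW_letterN ce) (diaW_mulr (U [:: e]) (sp a) (sp c)).
  have [x ->] := isP_Pbr aP; have [y ->] := isP_Pbr cP.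
  by rewrite -/(Pw x) -/(Pw y) diaWU diaw_PP -PWD diaW_PW_letter.
rewrite (diaW_letterN ac) (diaW_mull (U [:: a]) (sp c) (sp e)).
have [/andP[cP eP]|ce] := boolP (isP c && isP e); last first.
  rewrite (diaW_letterN ce) (diaW_mulr (U [:: e]) (sp a) (sp c)).
  by rewrite diaW_letterN // mulrA.
have aP : ~~ isP a by move: ac; rewrite cP andbT.
have [x ->] := isP_Pbr cP; have [y ->] := isP_Pbr eP.
by rewrite -/(Pw x) -/(Pw y) diaWU diaw_PP -PWD diaW_letter_PW.
Qed.

(** Induction on the total P-depth.  The hypothesis is used only when the three
    meeting letters are P-brackets. *)
Lemma diaWA_words n u v w : (depP u + depP v + depP w < n)%N ->
  diaW (diaW (U u) (U v)) (U w) = diaW (U u) (diaW (U v) (U w)) :> kW.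
Proof.
elim: n u v w => [|n IH] u v w uvw; first by exfalso; rewrite ltn0 in uvw.
rewrite ltnS in uvw.
have sp a' : spanned (@nonnil X) (U [:: a']) by apply: spannedU.
have letterA a c e : a \in u -> c \in v -> e \in w ->
  diaW (diaW (U [:: a]) (U [:: c])) (U [:: e]) =
  diaW (U [:: a]) (diaW (U [:: c]) (U [:: e])) :> kW.
  move=> /depP_mem au /depP_mem cv /depP_mem ew.
  have {uvw au cv ew} ace := leq_trans (leq_add (leq_add au cv) ew) uvw.
  have [/and3P[]|] := boolP [&& isP a, isP c & isP e];
    last exact: diaW_letterA_nonPPP.
  move=> /isP_Pbr[x ax] /isP_Pbr[y cy] /isP_Pbr[z ez]; rewrite {}ax {}cy {}ez in ace *.
  move: ace; rewrite -!depP_letterE -![[:: Pbr _]]/(Pw _) !depP_Pw => xyz.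
  rewrite -!PWU; apply: (RotaBaxter_assoc_step (@diaWDl k X) (@diaWDr k X)
    (@PWD k X) (@diaW_PW k X)); rewrite !PWU; apply: IH; apply: leq_trans xyz;
    by rewrite !depP_Pw !addSn !addnS.
(* An empty factor is the unit; the other words are split at their ends. *)
clear uvw; case/lastP: u letterA => [|u a] letterA.
  by rewrite -malg1E !diaW1l.
case: w letterA => [|e w] letterA.
  by rewrite -malg1E !diaW1r.
case: v letterA => [|c v] letterA.
  by rewrite -malg1E diaW1r diaW1l.
have {}letterA c' : c' \in c :: v ->
    diaW (diaW (U [:: a]) (U [:: c'])) (U [:: e]) =
    diaW (U [:: a]) (diaW (U [:: c']) (U [:: e])).
  by move=> ?; apply: letterA; rewrite ?mem_head // mem_rcons mem_head.
rewrite malg_rcons (malg_cons e w).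
have ns x y : spanned (@nonnil X) (diaW (U [:: x]) (U [:: y])).
  by rewrite diaWU; apply: diaw_letter_nonnil.
case/lastP: v letterA => [|v c'] letterA.
  apply: local_assoc_letter; try by move=> g h; apply: diaW_mul.
  by apply: letterA; rewrite mem_head.
rewrite (malg_cons c) malg_rcons.
by apply: local_assoc => g h; apply: diaW_mul.
Qed.

Theorem diaWA : associative diaW.
Proof.
move=> f g h; apply: esym.
move: f; apply: eq_linear => [c x y|c x y|u];
  [by rewrite !diaW_linl|by rewrite diaW_linl|].
move: g; apply: eq_linear => [c x y|c x y|v];
  [by rewrite diaW_linr !diaW_linl|by rewrite diaW_linl diaW_linr|].
move: h; apply: eq_linear => [c x y|c x y|w];
  [by rewrite diaW_linr|by rewrite !diaW_linr|].
exact: diaWA_words (leqnn _).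
Qed.

Variable b : k.

Lemma dW_mul f g : dW b (f * g) = dW b f * g + f * dW b g.
Proof.
move: f; apply: eq_linear => [c x y|c x y|u];
  [by rewrite malg_mul_linl dW_lin|by rewrite dW_lin !malg_mul_linl scalerDr addrACA|].
move: g; apply: eq_linear => [c x y|c x y|v];
  [by rewrite malg_mul_linr dW_lin|by rewrite dW_lin !malg_mul_linr scalerDr addrACA|].
by rewrite mulUU !dWU dw_cat.
Qed.

Lemma dW_PW g : dW b (PW g) = PW (dW b g) + b *: PW g.
Proof.
move: g; apply: eq_linear => [c x y|c x y|u];
  [by rewrite PW_lin dW_lin|rewrite dW_lin !PW_lin !scalerDr scalerA|].
  by rewrite [b * c]mulrC -scalerA addrACA.
by rewrite PWU !dWU dw_P.
Qed.

Lemma dwE a : dw b [:: a] = d_letter b a.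
Proof. by rewrite dw_cons /dw /= mulr0 addr0 mulr1. Qed.

Lemma dw_nonP a : ~~ isP a -> dw b [:: a] = U (Dw [:: a]).
Proof. by rewrite dwE; case: a. Qed.

(** The derivative of a P-bracket is P of something: d respects the two kinds
    of letters, which keeps junctions of concatenation type unchanged. *)
Lemma dw_Pbr z : dw b [:: Pbr z] = PW (dw b z + b *: U z).
Proof. by rewrite PWD PWZ PWU dwE. Qed.

Lemma dw_letter_nonnil a : spanned (@nonnil X) (dw b [:: a]).
Proof.
have [/isP_Pbr[z ->]|aP] := boolP (isP a); last first.
  by rewrite dw_nonP //; apply: spannedU.
rewrite dw_Pbr; apply: spannedS (@PW_bracketP _ _ _) => w.
exact: bracketP_nonnil.
Qed.

Lemma dW_letter_nonPP a c : ~~ (isP a && isP c) ->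
  dW b (diaW (U [:: a]) (U [:: c])) =
  diaW (dW b (U [:: a])) (U [:: c]) + diaW (U [:: a]) (dW b (U [:: c])).
Proof.
move=> ac; rewrite (diaW_letterN ac) dW_mul !dWU; congr (_ + _).
  have [/isP_Pbr[z az]|aP] := boolP (isP a); last first.
    by rewrite dw_nonP // diaW_letterN.
  by move: ac; rewrite az dw_Pbr => cP; rewrite (diaW_PW_letter _ cP).
have [/isP_Pbr[z cz]|cP] := boolP (isP c); last first.
  by rewrite dw_nonP // diaW_letterN // andbF.
by move: ac; rewrite cz dw_Pbr andbT => aP; rewrite (diaW_letter_PW _ aP).
Qed.

(** The reduction to letters and the induction are those of [diaWA_words]. *)
Lemma dW_Leibniz_words n u v : (depP u + depP v < n)%N ->
  dW b (diaW (U u) (U v)) =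
  diaW (dW b (U u)) (U v) + diaW (U u) (dW b (U v)).
Proof.
elim: n u v => [|n IH] u v uv; first by exfalso; rewrite ltn0 in uv.
rewrite ltnS in uv.
have sp a' : spanned (@nonnil X) (U [:: a']) by apply: spannedU.
have sd a' : spanned (@nonnil X) (dW b (U [:: a'])).
  by rewrite dWU; apply: dw_letter_nonnil.
have letterL a c : a \in u -> c \in v ->
  dW b (diaW (U [:: a]) (U [:: c])) =
  diaW (dW b (U [:: a])) (U [:: c]) + diaW (U [:: a]) (dW b (U [:: c])).
  move=> /depP_mem au /depP_mem cv.
  have {uv au cv} ac := leq_trans (leq_add au cv) uv.
  have [/andP[]|] := boolP (isP a && isP c); last exact: dW_letter_nonPP.
  move=> /isP_Pbr[x ax] /isP_Pbr[y cy]; rewrite {}ax {}cy in ac *.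
  move: ac; rewrite -!depP_letterE -![[:: Pbr _]]/(Pw _) !depP_Pw => xy.
  rewrite -!PWU; apply: (RotaBaxter_Leibniz_step (@diaWDl k X) (@diaWDr k X)
    (@PWD k X) (@diaW_PW k X) (@diaWZl k X) (@diaWZr k X) (@PWZ k X)
    (@dWD k X b) dW_PW); rewrite !PWU; apply: IH; apply: leq_trans xy;
    by rewrite !depP_Pw !addSn !addnS.
have dW1 : dW b 1 = 0 :> kW by rewrite malg1E dWU.
clear uv; case/lastP: u letterL => [|u a] letterL.
  by rewrite -malg1E !diaW1l dW1 diaW0l add0r.
case: v letterL => [|c v] letterL.
  by rewrite -malg1E !diaW1r dW1 diaW0r addr0.
have {}letterL := letterL a c; rewrite mem_rcons !mem_head in letterL.
rewrite malg_rcons (malg_cons c v).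
apply: (local_Leibniz (@diaWDl k X) (@diaWDr k X) dW_mul); last exact: letterL.
all: by move=> g h; apply: diaW_mul.
Qed.

Theorem dW_Leibniz f g : dW b (diaW f g) = diaW (dW b f) g + diaW f (dW b g).
Proof.
move: f; apply: eq_linear => [c x y|c x y|u];
  [by rewrite diaW_linl dW_lin|by rewrite dW_lin !diaW_linl scalerDr addrACA|].
move: g; apply: eq_linear => [c x y|c x y|v];
  [by rewrite diaW_linr dW_lin|by rewrite dW_lin !diaW_linr scalerDr addrACA|].
exact: dW_Leibniz_words (leqnn _).
Qed.
End WordAlgebra.

(** * Evaluation in a para-differential Rota-Baxter algebra *)

Section Evaluation.
Variables (k : comNzRingType) (X : Type) (b : k).
Variables (R : lmodType k) (mul : R -> R -> R) (d P : R -> R) (f : X -> R).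
Implicit Types (u v w : word X) (a : letter X).
Local Notation kW := {malg k[word X]}.
Local Notation U w := (<< (w : word X) >> : kW).
Implicit Types (g h : kW).

(** R may have no identity, so the product starts from the last letter.  The
    value 0 at the empty word is a default; it makes [eval_dw] hold for every
    word. *)
Definition prod_letters (el : letter X -> R) : word X -> R :=
  fix ev (w : word X) : R :=
    if w is a :: w' then if w' is [::] then el a else mul (el a) (ev w') else 0.

Fixpoint eval_letter a : R :=
  match a with
  | Gen x => f x
  | Dbr w => d (prod_letters eval_letter w)
  | Pbr w => P (prod_letters eval_letter w)
  end.

Definition eval_word : word X -> R := prod_letters eval_letter.

Definition eval : kW -> R := lext eval_word.

Hypothesis HR : is_paradiffRB3 b mul d P.

Lemma mulRA : associative mul. Proof. by case: HR => -[]. Qed.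

Lemma mulR_linl c x y z : mul (c *: x + y) z = c *: mul x z + mul y z.
Proof. by case: HR => -[_ L _] _ _ _; apply: (L z c x y). Qed.

Lemma mulR_linr c x y z : mul z (c *: x + y) = c *: mul z x + mul z y.
Proof. by case: HR => -[_ _ L] _ _ _; apply: (L z c x y). Qed.

Lemma dR_lin c x y : d (c *: x + y) = c *: d x + d y.
Proof. by case: HR => _ [L _ _] _ _; apply: L. Qed.

Lemma PR_lin c x y : P (c *: x + y) = c *: P x + P y.
Proof. by case: HR => _ _ [L _] _; apply: L. Qed.

Lemma dR_mul x y : d (mul x y) = mul (d x) y + mul x (d y).
Proof. by case: HR => _ [_ L _] _ _; apply: L. Qed.

Lemma mulR_PP x y : mul (P x) (P y) = P (mul (P x) y) + P (mul x (P y)).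
Proof. by case: HR => _ _ [_ L] _; apply: L. Qed.

Lemma dR_PR x : d (P x) = P (d x) + b *: P x.
Proof. by case: HR. Qed.

Lemma dR0 : d 0 = 0.
Proof. by have := dR_lin (-1) 0 0; rewrite scaler0 addr0 scaleN1r addNr. Qed.

Lemma eval_lin c g h : eval (c *: g + h) = c *: eval g + eval h.
Proof. exact: lext_linear. Qed.

Lemma evalD g h : eval (g + h) = eval g + eval h.
Proof. by have := eval_lin 1 g h; rewrite !scale1r. Qed.

Lemma evalU w : eval (U w) = eval_word w.
Proof. exact: lextU. Qed.

Lemma eval_word_cons a w : w <> [::] ->
  eval_word (a :: w) = mul (eval_letter a) (eval_word w).
Proof. by case: w. Qed.

Lemma eval_word_cat u v : u <> [::] -> v <> [::] ->
  eval_word (cat_word u v) = mul (eval_word u) (eval_word v).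
Proof.
elim: u => // a u IH _ v0; have [->|/eqP u0] := eqVneq u [::].
  by rewrite [cat_word _ _]/= eval_word_cons.
have uv0 : cat_word u v <> [::] by case: (u) u0.
rewrite -[cat_word _ _]/(a :: cat_word u v) !eval_word_cons //.
by rewrite IH // mulRA.
Qed.

Lemma eval_mul g h : spanned (@nonnil X) g -> spanned (@nonnil X) h ->
  eval (g * h) = mul (eval g) (eval h).
Proof.
move=> ng nh.
move: g ng; apply: eq_linear_spanned => [c x y|c x y|u nu];
  [by rewrite malg_mul_linl eval_lin|by rewrite eval_lin mulR_linl|].
move: h nh; apply: eq_linear_spanned => [c x y|c x y|v nv];
  [by rewrite malg_mul_linr eval_lin|by rewrite eval_lin mulR_linr|].
by rewrite mulUU !evalU eval_word_cat.
Qed.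

Lemma eval_PW g : eval (PW g) = P (eval g).
Proof.
move: g; apply: eq_linear => [c x y|c x y|u];
  [by rewrite PW_lin eval_lin|by rewrite eval_lin PR_lin|].
by rewrite PWU !evalU.
Qed.

Lemma dw_nonnil w : spanned (@nonnil X) (dw b w).
Proof.
elim: w => [|a w IH]; first exact: spanned0.
rewrite dw_cons -dwE; apply: spannedD.
  have := spannedM (@dw_letter_nonnil k X b a) (@spannedU k X [set w] _ erefl).
  by apply: spannedS => _ [u nu [v _ <-]]; case: u nu.
have := spannedM (@spannedU k X [set [:: a]] _ erefl) IH.
by apply: spannedS => _ [u -> [v _ <-]].
Qed.

(** The outer induction, on the P-depth, serves the letters of w which are
    P-brackets; the inner one, on the length, is the Leibniz rule in R. *)
Lemma eval_dw w : eval (dw b w) = d (eval_word w).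
Proof.
have [n] := ubnP (depP w); elim: n w => [//|n IH] w wn.
have letterd a : a \in w -> eval (dw b [:: a]) = d (eval_letter a).
  move=> aw; have [/isP_Pbr[z az]|aP] := boolP (isP a); last first.
    by rewrite dw_nonP // evalU.
  have zn : (depP z < n)%N.
    have := depP_mem aw; rewrite az => zw; exact: leq_trans zw wn.
  by rewrite az dw_Pbr eval_PW addrC eval_lin evalU (IH _ zn) PR_lin addrC -dR_PR.
elim: w letterd {wn} => [|a w IHw] letterd.
  by rewrite dR0 /eval /lext msupp0 big_seq_fset0.
have {}IHw : eval (dw b w) = d (eval_word w).
  by apply: IHw => c cw; apply: letterd; rewrite inE cw orbT.
have da := letterd a (mem_head _ _).
have [->|/eqP w0] := eqVneq w [::]; first exact: da.
rewrite dw_cons -dwE evalD eval_mul; last by apply: spannedU.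
  rewrite eval_mul; [|by apply: spannedU|exact: dw_nonnil].
  by rewrite da IHw !evalU (eval_word_cons a w0) dR_mul.
exact: dw_letter_nonnil.
Qed.

Lemma eval_dW g : eval (dW b g) = d (eval g).
Proof.
move: g; apply: eq_linear => [c x y|c x y|u];
  [by rewrite dW_lin eval_lin|by rewrite eval_lin dR_lin|].
by rewrite dWU evalU eval_dw.
Qed.

Lemma Xinf_Pbr_mem w z : Xinf w -> Pbr z \in w -> Xinf z.
Proof.
by move=> /XinfE[_ _ Zw] /Zw[/Delta_notP //|[z' Xz' [->]]].
Qed.

(** This fails for words with an empty P-bracket, whose value P(0) does not
    reflect that the empty word is a unit; hence the restriction to Xinf, which
    the recursion preserves. *)
Lemma eval_diaw u v : Xinf u -> Xinf v ->
  eval (diaw k u v) = mul (eval_word u) (eval_word v).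
Proof.
have [n] := ubnP (depP u + depP v); elim: n u v => [//|n IH] u v uv Xu Xv.
have letterM a c : a \in u -> c \in v ->
    eval (diaw k [:: a] [:: c]) = mul (eval_letter a) (eval_letter c).
  move=> au cv.
  have [/andP[/isP_Pbr[x ax] /isP_Pbr[y cy]]|ac] := boolP (isP a && isP c); last first.
    by rewrite diaw_cat // evalU eval_word_cat.
  rewrite ax cy in au cv *.
  have [Xx Xy] := (Xinf_Pbr_mem Xu au, Xinf_Pbr_mem Xv cv).
  have xy := leq_ltn_trans (leq_add (depP_mem au) (depP_mem cv)) uv.
  move: xy; rewrite /= addSn addnS ltnS => xy.
  have [XPx XPy] := ((Xinf_Pw x).2 Xx, (Xinf_Pw y).2 Xy).
  have evalRB A B : eval A = mul (eval_word x) (eval_word (Pw y)) ->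
      eval B = mul (eval_word (Pw x)) (eval_word y) ->
      eval (PW A + PW B) = mul (eval_word (Pw x)) (eval_word (Pw y)).
    by move=> EA EB; rewrite evalD !eval_PW EA EB addrC -mulR_PP.
  rewrite -/(Pw x) -/(Pw y) diaw_PP.
  by apply: evalRB; apply: IH; rewrite // depP_Pw (addnS, addSn).
case/lastP: u Xu letterM {uv} => [|u a] Xu letterM; first by have := Xinf_neq0 Xu.
case: v Xv letterM => [|c v] Xv letterM; first by have := Xinf_neq0 Xv.
have {}letterM : eval (diaw k [:: a] [:: c]) = mul (eval_letter a) (eval_letter c).
  by apply: letterM; rewrite ?mem_head // mem_rcons mem_head.
have nac := @diaw_letter_nonnil k X a c.
rewrite diaw_rcons_cons.
have evu g : spanned (@nonnil X) g -> eval (U u * g) =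
    if u is [::] then eval g else mul (eval_word u) (eval g).
  case: (u) => [|a' u'] ng; first by rewrite -malg1E mul1r.
  by rewrite eval_mul ?evalU //; apply: spannedU.
have evv g : spanned (@nonnil X) g -> eval (g * U v) =
    if v is [::] then eval g else mul (eval g) (eval_word v).
  case: (v) => [|a' u'] ng; first by rewrite -malg1E mulr1.
  by rewrite eval_mul ?evalU //; apply: spannedU.
have -> : eval_word (rcons u a) =
    if u is [::] then eval_letter a else mul (eval_word u) (eval_letter a).
  by case: (u) => // a' u'; rewrite -cats1 -/(cat_word _ _) eval_word_cat.
have -> : eval_word (c :: v) =
    if v is [::] then eval_letter c else mul (eval_letter c) (eval_word v).
  by case: (v).
rewrite evv; last first.
  have := spannedM (@spannedU k X [set u] _ erefl) nac.
  by apply: spannedS => _ [x _ [y ny <-]]; case: x => //; case: y ny.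
rewrite evu // letterM.
by case: (u) => [|? ?]; case: (v) => [|? ?]; rewrite ?mulRA.
Qed.

Lemma eval_diaW g h : spanned Xinf g -> spanned Xinf h ->
  eval (diaW g h) = mul (eval g) (eval h).
Proof.
move=> Xg Xh.
move: g Xg; apply: eq_linear_spanned => [c x y|c x y|u Xu];
  [by rewrite diaW_linl eval_lin|by rewrite eval_lin mulR_linl|].
move: h Xh; apply: eq_linear_spanned => [c x y|c x y|v Xv];
  [by rewrite diaW_linr eval_lin|by rewrite eval_lin mulR_linr|].
by rewrite diaWU !evalU eval_diaw.
Qed.

Lemma kXval_linear : linear (@kXval k X).
Proof. by move=> c x y; rewrite -[LHS]/(val _) linearP. Qed.

Lemma kXvalD (u v : kXinf k X) : kXval (u + v) = kXval u + kXval v.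
Proof. by have := kXval_linear 1 u v; rewrite !scale1r. Qed.

(** [wordX] takes a proof of membership in Xinf, which a sum over a finite
    set of words cannot supply; W is its extension to all words. *)
Lemma kXinf_sumE (F : kXinf k X) : exists W : word X -> kXinf k X,
  (forall w (Xw : Xinf w), W w = wordX k Xw) /\
  F = \sum_(w <- msupp (kXval F)) (kXval F)@_w *: W w.
Proof.
pose W w := if pselect (Xinf w) is left Xw then wordX k Xw else 0.
have WE w (Xw : Xinf w) : W w = wordX k Xw.
  by rewrite /W; case: pselect => // Xw'; apply: val_inj.
exists W; split=> //; apply: val_inj.
rewrite -[LHS]/(kXval F) -[RHS]/(kXval _) linear_lincomb; last exact: kXval_linear.
rewrite [LHS]malg_spanE big_seq [RHS]big_seq; apply: eq_bigr => w /kXvalP Xw.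
by rewrite (WE _ Xw).
Qed.

Section Uniqueness.
Variable F : kXinf k X -> R.
Hypothesis F_hom : is_alg_hom (@diaX k X) mul F.
Hypothesis F_d : forall h : kXinf k X, F (dX b h) = d (F h).
Hypothesis F_P : forall h : kXinf k X, F (PX h) = P (F h).
Hypothesis F_j : forall x, F (jX k x) = f x.

(** A letter is an iterated derivative of a generator or P of a smaller word of
    Xinf; a longer word is the product of its first letter and the rest, which
    is a concatenation as no two P-brackets are adjacent in Xinf. *)
Lemma hom_wordX w (Xw : Xinf w) : F (wordX k Xw) = eval_word w.
Proof.
have [n] := ubnP (depP w); elim: n w Xw => [//|n IH] w.
elim: w => [|a w IHw] Xw wn; first by have := Xinf_neq0 Xw.
have letterF (Xa : Xinf [:: a]) : F (wordX k Xa) = eval_letter a.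
  have /XinfE[_ _ Za] := Xa; case: (Za a (mem_head _ _)) => [Da|[z Xz az]].
    move: Da => [x [m]]; elim: m a Xa {Za Xw wn IHw} => [|m IHm] a Xa /=.
      by case=> ax; rewrite {}ax in Xa *; rewrite [RHS]/= -F_j; congr F; apply: val_inj.
    case=> am; rewrite {}am in Xa *.
    have Dm : Delta (iter m (@Dw X) (Gw x)) by exists x, m.
    have [a' a'E _] := Delta_letter Dm; rewrite a'E in Dm Xa *.
    have Xa' : Xinf [:: a'] by apply/Xinf_X0/X0E; split=> // e; rewrite inE => /eqP->.
    rewrite /= -/(eval_word [:: a']) -(IHm _ Xa') // -F_d; congr F; apply: val_inj.
    by rewrite /= dWU dw_Delta.
  rewrite {}az in Xa wn *.
  rewrite /= -/(eval_word z) -(IH _ Xz); last first.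
    by move: wn; rewrite ltnS; apply: leq_trans; apply: (@depP_mem _ _ (Pbr z)); rewrite mem_head.
  by rewrite -F_P; congr F; apply: val_inj; rewrite /= PWU.
have [w0|/eqP w0] := eqVneq w [::]; first by subst w; exact: letterF.
have [//|Xa Xw' aw] := (Xinf_cat (u := [:: a]) _ w0).1 Xw.
have -> : wordX k Xw = diaX (wordX k Xa) (wordX k Xw').
  by apply: val_inj; rewrite /= diaWU diaw_cat.
rewrite F_hom.2 letterF IHw ?eval_word_cons //.
by move: wn; rewrite /depP /= !ltnS geq_max => /andP[].
Qed.

Lemma hom_evalE (u : kXinf k X) : F u = eval (kXval u).
Proof.
have [W [WE uE]] := kXinf_sumE u; have [linF _] := F_hom.
rewrite {1}uE linear_lincomb // /eval /lext big_seq [RHS]big_seq.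
by apply: eq_bigr => w /kXvalP Xw; rewrite (WE _ Xw) hom_wordX.
Qed.
End Uniqueness.

End Evaluation.

(** * The free para-differential Rota-Baxter algebra *)

Lemma kXinf_paradiff (k : comNzRingType) (X : Type) (b : k) :
  is_paradiffRB3 b (@diaX k X) (@dX k X b) (@PX k X).
Proof.
have dX_L x y : dX b (diaX x y) = diaX (dX b x) y + diaX x (dX b y) :> kXinf k X.
  by apply: val_inj; rewrite [RHS]kXvalD; exact: dW_Leibniz.
split; [split|split|split|].
- by move=> x y z; apply: val_inj; rewrite /= diaWA.
- by move=> z c x y; apply: val_inj; rewrite [RHS]kXval_linear -diaW_linl -kXval_linear.
- by move=> z c x y; apply: val_inj; rewrite [RHS]kXval_linear -diaW_linr -kXval_linear.
- by move=> c x y; apply: val_inj; rewrite [RHS]kXval_linear -dW_lin -kXval_linear.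
- exact: dX_L.
(* d(e) = d(e e) = d(e) + d(e). *)
- move=> e el er; apply: (@addrI _ (dX b e)); rewrite addr0.
  by have := dX_L e e; rewrite el er el.
- by move=> c x y; apply: val_inj; rewrite [RHS]kXval_linear -PW_lin -kXval_linear.
- by move=> x y; apply: val_inj; rewrite addrC [RHS]kXvalD; exact: diaW_PW.
- move=> x; apply: val_inj; rewrite addrC [RHS]kXval_linear addrC.
  exact: dW_PW.
Qed.

Theorem theorem5p10 (k : comNzRingType) (X : Type) (b : k) (hb : b != 0) :
  is_paradiffRB3 b (@diaX k X) (@dX k X b) (@PX k X) /\
  forall (R : lmodType k) (mul : R -> R -> R) (d P : R -> R),
    is_paradiffRB3 b mul d P ->
    forall f : X -> R,
      exists! fbar : kXinf k X -> R,
        [/\ is_alg_hom (@diaX k X) mul fbar,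
            forall u, fbar (dX b u) = d (fbar u),
            forall u, fbar (PX u) = P (fbar u)
          & forall x, fbar (jX k x) = f x].
Proof.
split; first exact: kXinf_paradiff.
move=> R mul d P HR f; exists (fun u => eval mul d P f (kXval u)); split.
  split; [split|..].
  - by move=> c u v; rewrite kXval_linear eval_lin.
  - by move=> u v; apply: (eval_diaW _ HR); apply: kXvalP.
  - by move=> u; apply: eval_dW.
  - by move=> u; rewrite (eval_PW _ HR).
  - by move=> x; rewrite evalU.
move=> F [F_hom F_d F_P F_j]; apply/funext => u.
by rewrite (hom_evalE F_hom F_d F_P F_j).
Qed.
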